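(* Let $R$ be a super ring, let $P$ be a right $R$-module which is a progenerator in $\mathfrak{M}_R$, and put $Q := \underline{Hom}_R(P,R)$ and $S := \underline{End}_R(P)$, so that $P$ is an $(S,R)$-bimodule and $Q$ is an $(R,S)$-bimodule. Then: (1) the functors $-\otimes_R Q : \mathfrak{M}_R \to \mathfrak{M}_S$ and $-\otimes_S P : \mathfrak{M}_S \to \mathfrak{M}_R$ are mutually inverse category equivalences; (2) the functors $P \otimes_R - : {}_R\mathfrak{M} \to {}_S\mathfrak{M}$ and $Q \otimes_S - : {}_S\mathfrak{M} \to {}_R\mathfrak{M}$ are mutually inverse category equivalences.
   Context: A super ring is an associative (not necessarily commutative) unital ring $R = R_0\oplus R_1$ graded by $\mathbb{Z}_2$ with $R_iR_j\subseteq R_{i+j}$. All modules are $\mathbb{Z}_2$-graded with action compatible with the grading; $|x|\in\{0,1\}$ denotes the parity of a homogeneous element. $\mathfrak{M}_R$ (resp. ${}_R\mathfrak{M}$) is the category of right (resp. left) graded $R$-modules whose morphisms $Hom_R(M,N)$ are the parity-preserving $R$-module homomorphisms. For right modules, $\underline{Hom}_R(M,N)$ is the set of all $R$-linear maps $M\to N$, with even part the parity-preserving and odd part the parity-reversing maps; $\underline{End}_R(P)=\underline{Hom}_R(P,P)$ is a super ring under composition. $(SAb)$ is the category of $\mathbb{Z}_2$-graded abelian groups with parity-preserving homomorphisms. $P\in\mathfrak{M}_R$ is projective if $Hom_R(P,-)$ is exact; it is a generator if $\underline{Hom}_R(P,-):\mathfrak{M}_R\to(SAb)$ is faithful, i.e.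 for each morphism $f:M\to N$ in $\mathfrak{M}_R$, $f_*=0$ on $\underline{Hom}_R(P,M)$ implies $f=0$; a progenerator is a finitely generated projective generator. $S$ acts on $P$ on the left by evaluation. $Q$ has left $R$-action $(rq)(p)=r(q(p))$ and right $S$-action $(qs)(p)=q(s(p))$. The tensor product of graded modules is the usual one with grading $(M\otimes_R N)_k=\bigoplus_{i+j=k}M_i\otimes_R N_j$. ''Mutually inverse'' means that the composites are naturally isomorphic to the identity functors. *)

(* Defs.v *)
From HB Require Import structures.
From mathcomp Require Import all_boot all_algebra.
From mathcomp Require Import boolp classical_sets functions.
From mathcomp Require Import freeg.

Set Implicit Arguments.
Unset Strict Implicit.
Unset Printing Implicit Defensive.

Import GRing.Theory.
Local Open Scope ring_scope.

(* The group Z_2 of degrees is [bool] with exclusive or: [false] is the even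
   degree 0 and [true] the odd degree 1. *)
HB.mixin Record isSuperZmodule V of GRing.Zmodule V := {
  grade : bool -> V -> Prop;
  grade0 : forall i, grade i 0;
  gradeB : forall i x y, grade i x -> grade i y -> grade i (x - y);
  grade_split : forall x, exists x0 x1,
    [/\ grade false x0, grade true x1 & x = x0 + x1];
  grade_disjoint : forall x, grade false x -> grade true x -> x = 0
}.

#[short(type="superZmodType")]
HB.structure Definition SuperZmodule :=
  {V of isSuperZmodule V & GRing.Zmodule V}.

(* That 1 is even follows from these axioms. *)
HB.mixin Record isSuperRing R of SuperZmodule R & GRing.PzRing R := {
  gradeM : forall i j (x y : R),
    grade i x -> grade j y -> grade (i (+) j) (x * y)
}.

#[short(type="superRingType")]
HB.structure Definition SuperRing :=
  {R of isSuperRing R & SuperZmodule R & GRing.PzRing R}.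

HB.mixin Record isSuperLmodule (R : superRingType) V
    of SuperZmodule V & GRing.Lmodule R V := {
  gradeZ : forall i j (r : R) (x : V),
    grade i r -> grade j x -> grade (i (+) j) (r *: x)
}.

#[short(type="superLmodType")]
HB.structure Definition SuperLmodule (R : superRingType) :=
  {V of isSuperLmodule R V & SuperZmodule V & GRing.Lmodule R V}.

(* Right modules are not encoded as left modules over R^c, because bimodules
   need both actions on one carrier. *)
HB.mixin Record isSuperRmodule (R : superRingType) V of SuperZmodule V := {
  ract : V -> R -> V;
  ractA : forall v a b, ract (ract v a) b = ract v (a * b);
  ract1 : forall v, ract v 1 = v;
  ractDl : forall u v a, ract (u + v) a = ract u a + ract v a;
  ractDr : forall v a b, ract v (a + b) = ract v a + ract v b;
  grade_ract : forall i j v a,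
    grade i v -> grade j a -> grade (i (+) j) (ract v a)
}.

#[short(type="superRmodType")]
HB.structure Definition SuperRmodule (R : superRingType) :=
  {V of isSuperRmodule R V & SuperZmodule V}.

Notation "v :* r" := (ract v r) : ring_scope.

HB.mixin Record isSuperBimodule (S R : superRingType) V
    of SuperLmodule S V & SuperRmodule R V := {
  bimodA : forall (s : S) (v : V) (r : R), (s *: v) :* r = s *: (v :* r)
}.

#[short(type="superBimodType")]
HB.structure Definition SuperBimodule (S R : superRingType) :=
  {V of isSuperBimodule S R V & SuperLmodule S V & SuperRmodule R V}.

Section GradeTheory.
Variable V : superZmodType.
Implicit Types (x y : V) (i : bool).

Lemma gradeN i x : grade i x -> grade i (- x).
Proof. by move=> hx; rewrite -[- x]add0r; apply: gradeB => //; exact: grade0. Qed.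

Lemma gradeD i x y : grade i x -> grade i y -> grade i (x + y).
Proof. by move=> hx hy; rewrite -[y]opprK; apply: gradeB => //; exact: gradeN. Qed.

Lemma grade_part_exists i x : exists y, grade i y /\ grade (~~ i) (x - y).
Proof.
have [x0 [x1 [h0 h1 ->]]] := grade_split x.
case: i; first by exists x1; rewrite addrK.
by exists x0; rewrite addrC addKr.
Qed.

(* The component of degree i. *)
Definition part i x : V :=
  projT1 (constructive_indefinite_description (grade_part_exists i x)).

Lemma part_grade i x : grade i (part i x).
Proof. by rewrite /part; case: constructive_indefinite_description => y []. Qed.

Lemma part_compl i x : grade (~~ i) (x - part i x).
Proof. by rewrite /part; case: constructive_indefinite_description => y []. Qed.

Lemma grade_disj i x : grade i x -> grade (~~ i) x -> x = 0.
Proof. by case: i => /= h1 h2; apply: grade_disjoint. Qed.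

Lemma part_eq i x y : grade i y -> grade (~~ i) (x - y) -> part i x = y.
Proof.
move=> h1 h2; apply/eqP; rewrite -subr_eq0; apply/eqP; apply: (@grade_disj i).
  by apply: gradeB => //; exact: part_grade.
have -> : part i x - y = (x - y) - (x - part i x).
  by rewrite opprB [RHS]addrC addrA subrK.
by apply: gradeB => //; exact: part_compl.
Qed.

Lemma part_id i x : grade i x -> part i x = x.
Proof. by move=> h; apply: part_eq => //; rewrite subrr; exact: grade0. Qed.

Lemma part_neg i x : grade (~~ i) x -> part i x = 0.
Proof. by move=> h; apply: part_eq; [exact: grade0 | rewrite subr0]. Qed.

Lemma partB i x y : part i (x - y) = part i x - part i y.
Proof.
apply: part_eq; first by apply: gradeB; exact: part_grade.
have -> : x - y - (part i x - part i y) = (x - part i x) - (y - part i y).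
  by rewrite !opprD !opprK addrACA.
by apply: gradeB; exact: part_compl.
Qed.

Lemma part0 i : part i (0 : V) = 0.
Proof. by apply: part_id; exact: grade0. Qed.

Lemma partN i x : part i (- x) = - part i x.
Proof. by rewrite -[- x]add0r partB part0 add0r. Qed.

Lemma partD i x y : part i (x + y) = part i x + part i y.
Proof. by rewrite -[y in LHS]opprK partB partN opprK. Qed.

Lemma part_sum x : part false x + part true x = x.
Proof.
have h : part true x = x - part false x.
  apply: part_eq; first exact: (part_compl false x).
  by rewrite opprB addrC subrK; exact: (part_grade false x).
by rewrite h addrC subrK.
Qed.

End GradeTheory.

Definition rlinear (R : superRingType) (M N : superRmodType R) (f : M -> N) :=
  forall (r : R) (u v : M), f (u :* r + v) = f u :* r + f v.

Section RactTheory.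
Variables (R : superRingType) (M : superRmodType R).
Implicit Types (u v : M) (r : R).

Lemma ract_zmod_morphism r : zmod_morphism (fun v : M => v :* r).
Proof. by move=> u v; apply/eqP; rewrite eq_sym subr_eq -ractDl subrK. Qed.

Lemma ract0l r : (0 : M) :* r = 0.
Proof. by have /= := ract_zmod_morphism r 0 0; rewrite !subrr. Qed.

Lemma ractBl u v r : (u - v) :* r = u :* r - v :* r.
Proof. exact: ract_zmod_morphism. Qed.

Lemma ractNl u r : (- u) :* r = - (u :* r).
Proof. by rewrite -[- u]add0r ractBl ract0l add0r. Qed.

Lemma ractBr v a b : v :* (a - b) = v :* a - v :* b.
Proof. by apply/eqP; rewrite eq_sym subr_eq -ractDr subrK. Qed.

Lemma part_ract k b v r :
  grade b r -> part (k (+) b) (v :* r) = part k v :* r.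
Proof.
move=> hr; apply: part_eq; first by apply: grade_ract => //; exact: part_grade.
rewrite -ractBl -addNb; apply: grade_ract => //; exact: part_compl.
Qed.

End RactTheory.

Lemma part_scale (R : superRingType) (M : superLmodType R) k b (v : M) (r : R) :
  grade b r -> part (k (+) b) (r *: v) = r *: part k v.
Proof.
move=> hr; rewrite addbC; apply: part_eq.
  by apply: gradeZ => //; exact: part_grade.
by rewrite -scalerBr -addbN; apply: gradeZ => //; exact: part_compl.
Qed.

Section RlinearTheory.
Variables (R : superRingType) (M N : superRmodType R) (f : M -> N).
Hypothesis lin_f : rlinear f.

Lemma rlinearD u v : f (u + v) = f u + f v.
Proof. by have := lin_f 1 u v; rewrite !ract1. Qed.

Lemma rlinear0 : f 0 = 0.
Proof. by apply: (addrI (f 0)); rewrite -rlinearD !addr0. Qed.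

Lemma rlinearZ v r : f (v :* r) = f v :* r.
Proof. by have := lin_f r v 0; rewrite rlinear0 !addr0. Qed.

Lemma rlinearN v : f (- v) = - f v.
Proof. by apply/eqP; rewrite -addr_eq0 -rlinearD addNr rlinear0. Qed.

Lemma rlinearB u v : f (u - v) = f u - f v.
Proof. by rewrite rlinearD rlinearN. Qed.

End RlinearTheory.

Section SuperHom.
Variables (R : superRingType) (M N : superRmodType R).

Definition rlinear_pred : {pred M -> N} := fun f => `[< rlinear f >].

Lemma rlinear_pred_zmod_closed : zmod_closed rlinear_pred.
Proof.
split=> [|f g /asboolP hf /asboolP hg]; apply/asboolP => r u v.
  by rewrite /= ract0l addr0.
rewrite -[LHS]/(f _ - g _) hf hg -[(f - g) u]/(f u - g u) -[(f - g) v]/(f v - g v).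
by rewrite ractBl opprD addrACA.
Qed.

HB.instance Definition _ :=
  GRing.isZmodClosed.Build (M -> N) rlinear_pred rlinear_pred_zmod_closed.

(* All R-linear maps, without any parity condition. *)
Record superHom := SuperHom {
  superHom_fun :> M -> N;
  superHom_in : superHom_fun \in rlinear_pred }.

HB.instance Definition _ := [isSub for superHom_fun].
HB.instance Definition _ := [Choice of superHom by <:].
HB.instance Definition _ := [SubChoice_isSubZmodule of superHom by <:].

Lemma superHom_lin (f : superHom) : rlinear f.
Proof. exact/asboolP/superHom_in. Qed.

Definition mkSuperHom (f : M -> N) (hf : rlinear f) : superHom :=
  SuperHom (introT (asboolP _) hf).

Lemma superHomP (f g : superHom) : (forall x, f x = g x) -> f = g.
Proof. by move=> e; apply/val_inj/funext. Qed.

Lemma superHom_addE (f g : superHom) x : (f + g) x = f x + g x.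
Proof. by []. Qed.

Lemma superHom_subE (f g : superHom) x : (f - g) x = f x - g x.
Proof. by []. Qed.

Lemma superHom_zeroE x : (0 : superHom) x = 0.
Proof. by []. Qed.

Definition grade_superHom (i : bool) (f : superHom) : Prop :=
  forall j (x : M), grade j x -> grade (i (+) j) (f x).

(* The component of degree i of f. *)
Definition superHom_part i (f : superHom) (x : M) : N :=
  part i (f (part false x)) + part (~~ i) (f (part true x)).

Lemma superHom_partE i (f : superHom) a x :
  grade a x -> superHom_part i f x = part (i (+) a) (f x).
Proof.
have f0 := rlinear0 (superHom_lin f).
rewrite /superHom_part; case: a => hx.
  by rewrite (part_neg (i := false) hx) (part_id hx) f0 part0 add0r addbT.
by rewrite (part_neg (i := true) hx) (part_id hx) f0 part0 addr0 addbF.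
Qed.

Lemma superHom_partD i (f : superHom) x y :
  superHom_part i f (x + y) = superHom_part i f x + superHom_part i f y.
Proof.
by rewrite /superHom_part !partD !(rlinearD (superHom_lin f)) !partD addrACA.
Qed.

Lemma superHom_part_lin i (f : superHom) : rlinear (superHom_part i f).
Proof.
move=> r u v; rewrite superHom_partD; congr (_ + _).
have hom a b (x : M) (s : R) : grade a x -> grade b s ->
    superHom_part i f (x :* s) = superHom_part i f x :* s.
  move=> hx hs; rewrite (superHom_partE i f (grade_ract _ _ _ _ hx hs)).
  by rewrite (superHom_partE i f hx) (rlinearZ (superHom_lin f)) addbA part_ract.
rewrite -[u]part_sum -[r]part_sum ractDl !ractDr !superHom_partD.
rewrite !(ractDl (superHom_part i f (part false u))).
by do 4!rewrite (hom _ _ _ _ (part_grade _ _) (part_grade _ _)); rewrite addrACA.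
Qed.

Lemma superHom_grade0 i : grade_superHom i 0.
Proof. by move=> j x _; exact: grade0. Qed.

Lemma superHom_gradeB i f g :
  grade_superHom i f -> grade_superHom i g -> grade_superHom i (f - g).
Proof. by move=> hf hg j x hx; apply: gradeB; [exact: hf | exact: hg]. Qed.

Lemma superHom_grade_split f : exists f0 f1,
  [/\ grade_superHom false f0, grade_superHom true f1 & f = f0 + f1].
Proof.
have gr i : grade_superHom i (mkSuperHom (superHom_part_lin i f)).
  by move=> j x hx /=; rewrite (superHom_partE i f hx); exact: part_grade.
exists (mkSuperHom (superHom_part_lin false f)).
exists (mkSuperHom (superHom_part_lin true f)); split; [exact: gr | exact: gr |].
apply: superHomP => x; rewrite superHom_addE /= /superHom_part /= addrACA.
rewrite [X in _ + X]addrC part_sum part_sum.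
by rewrite -(rlinearD (superHom_lin f)) part_sum.
Qed.

Lemma superHom_grade_disjoint f :
  grade_superHom false f -> grade_superHom true f -> f = 0.
Proof.
move=> h0 h1; apply: superHomP => x.
have [x0 [x1 [hx0 hx1 ->]]] := grade_split x.
rewrite (rlinearD (@superHom_lin f)).
by rewrite (grade_disjoint _ (h0 _ _ hx0) (h1 _ _ hx0))
  (grade_disjoint _ (h1 _ _ hx1) (h0 _ _ hx1)) addr0.
Qed.

HB.instance Definition _ := isSuperZmodule.Build superHom
  superHom_grade0 superHom_gradeB superHom_grade_split superHom_grade_disjoint.

End SuperHom.

Section SuperHomComp.
Variables (R : superRingType) (L M N : superRmodType R).

Lemma superHom_comp_lin (g : superHom M N) (f : superHom L M) : rlinear (g \o f).
Proof. by move=> r u v /=; rewrite (superHom_lin f) (superHom_lin g). Qed.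

Definition superHom_comp (g : superHom M N) (f : superHom L M) : superHom L N :=
  mkSuperHom (superHom_comp_lin g f).

Lemma superHom_comp_grade i j (g : superHom M N) (f : superHom L M) :
  grade i g -> grade j f -> grade (i (+) j) (superHom_comp g f).
Proof. by move=> hg hf k x /hf /hg; rewrite addbA. Qed.

End SuperHomComp.

Section SuperEnd.
Variables (R : superRingType) (P : superRmodType R).

Lemma superHom_id_lin : rlinear (@id P).
Proof. by []. Qed.

Definition superHom_id : superHom P P := mkSuperHom superHom_id_lin.

Definition superEnd : Type := superHom P P.

HB.instance Definition _ := SuperZmodule.copy superEnd (superHom P P).

Lemma superEnd_mulA : associative (@superHom_comp R P P P).
Proof. by move=> f g h; apply: superHomP. Qed.

Lemma superEnd_mul1l : left_id superHom_id (@superHom_comp R P P P).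
Proof. by move=> f; apply: superHomP. Qed.

Lemma superEnd_mul1r : right_id superHom_id (@superHom_comp R P P P).
Proof. by move=> f; apply: superHomP. Qed.

Lemma superEnd_mulDl :
  left_distributive (@superHom_comp R P P P) (fun f g : superHom P P => f + g).
Proof. by move=> f g h; apply: superHomP. Qed.

Lemma superEnd_mulDr :
  right_distributive (@superHom_comp R P P P) (fun f g : superHom P P => f + g).
Proof.
by move=> f g h; apply: superHomP => x; exact: (rlinearD (superHom_lin f)).
Qed.

HB.instance Definition _ := GRing.Zmodule_isPzRing.Build superEnd
  superEnd_mulA superEnd_mul1l superEnd_mul1r superEnd_mulDl superEnd_mulDr.

HB.instance Definition _ := isSuperRing.Build superEnd
  (@superHom_comp_grade R P P P).

End SuperEnd.

Section RightRegular.
Variable R : superRingType.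

HB.instance Definition _ := SuperZmodule.copy R^o R.

HB.instance Definition _ := isSuperRmodule.Build R R^o
  (fun v a b => esym (mulrA v a b)) (@mulr1 R) (fun u v a => mulrDl u v a)
  (fun v a b => mulrDr v a b) (@gradeM R).

End RightRegular.

Section Dual.
Variables (R : superRingType) (P : superRmodType R).

Definition superDual : Type := superHom P R^o.

HB.instance Definition _ := SuperZmodule.copy superDual (superHom P R^o).

Lemma superDual_scale_lin (r : R) (q : superHom P R^o) :
  rlinear (fun p : P => r * q p : R^o).
Proof.
by move=> a u v; rewrite (superHom_lin q) mulrDr /ract /= mulrA.
Qed.

Definition superDual_scale (r : R) (q : superDual) : superDual :=
  mkSuperHom (superDual_scale_lin r q).

Lemma superDual_scaleA a b q :
  superDual_scale a (superDual_scale b q) = superDual_scale (a * b) q.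
Proof. by apply: superHomP => p; exact: mulrA. Qed.

Lemma superDual_scale1 : left_id 1 superDual_scale.
Proof. by move=> q; apply: superHomP => p; exact: mul1r. Qed.

Lemma superDual_scaleDr : right_distributive superDual_scale +%R.
Proof. by move=> r p q; apply: superHomP => x; exact: mulrDr. Qed.

Lemma superDual_scaleDl q : {morph superDual_scale^~ q : a b / a + b}.
Proof. by move=> a b; apply: superHomP => x; exact: mulrDl. Qed.

HB.instance Definition _ := GRing.Zmodule_isLmodule.Build R superDual
  superDual_scaleA superDual_scale1 superDual_scaleDr superDual_scaleDl.

Lemma superDual_gradeZ i j (r : R) (q : superDual) :
  grade i r -> grade j q -> grade (i (+) j) (r *: q).
Proof. by move=> hr hq k x /hq; rewrite -addbA; exact: gradeM. Qed.

HB.instance Definition _ := isSuperLmodule.Build R superDual superDual_gradeZ.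

Definition superDual_ract (q : superDual) (s : superEnd P) : superDual :=
  superHom_comp q s.

Lemma superDual_ractA q s t :
  superDual_ract (superDual_ract q s) t = superDual_ract q (s * t).
Proof. by apply: superHomP. Qed.

Lemma superDual_ract1 q : superDual_ract q 1 = q.
Proof. by apply: superHomP. Qed.

Lemma superDual_ractDl p q s :
  superDual_ract (p + q) s = superDual_ract p s + superDual_ract q s.
Proof. by apply: superHomP. Qed.

Lemma superDual_ractDr q s t :
  superDual_ract q (s + t) = superDual_ract q s + superDual_ract q t.
Proof. by apply: superHomP => x; exact: (rlinearD (superHom_lin q)). Qed.

Lemma superDual_grade_ract i j q s : grade i q -> grade j s ->
  grade (i (+) j) (superDual_ract q s).
Proof. exact: superHom_comp_grade. Qed.

HB.instance Definition _ := isSuperRmodule.Build (superEnd P) superDual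
  superDual_ractA superDual_ract1 superDual_ractDl superDual_ractDr
  superDual_grade_ract.

Lemma superDual_bimodA (r : R) (q : superDual) (s : superEnd P) :
  (r *: q) :* s = r *: (q :* s).
Proof. by apply: superHomP. Qed.

HB.instance Definition _ :=
  isSuperBimodule.Build R (superEnd P) superDual superDual_bimodA.

End Dual.

Section Evaluation.
Variables (R : superRingType) (P : superRmodType R).

(* P as an (End P, R)-bimodule, End P acting by evaluation. *)
Definition evalBimod : Type := P.

HB.instance Definition _ := SuperRmodule.copy evalBimod P.

Definition eval_scale (s : superEnd P) (p : evalBimod) : evalBimod :=
  (s : superHom P P) p.

Lemma eval_scaleA s t p : eval_scale s (eval_scale t p) = eval_scale (s * t) p.
Proof. by []. Qed.

Lemma eval_scale1 : left_id 1 eval_scale.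
Proof. by []. Qed.

Lemma eval_scaleDr : right_distributive eval_scale +%R.
Proof. by move=> s p q; exact: (rlinearD (superHom_lin s)). Qed.

Lemma eval_scaleDl p : {morph eval_scale^~ p : s t / s + t}.
Proof. by []. Qed.

HB.instance Definition _ := GRing.Zmodule_isLmodule.Build (superEnd P) evalBimod
  eval_scaleA eval_scale1 eval_scaleDr eval_scaleDl.

Lemma eval_gradeZ i j (s : superEnd P) (p : evalBimod) :
  grade i s -> grade j p -> grade (i (+) j) (s *: p).
Proof. by move=> hs; exact: hs. Qed.

HB.instance Definition _ :=
  isSuperLmodule.Build (superEnd P) evalBimod eval_gradeZ.

Lemma eval_bimodA (s : superEnd P) (p : evalBimod) (r : R) :
  (s *: p) :* r = s *: (p :* r).
Proof. exact: esym (rlinearZ (superHom_lin (s : superHom P P)) p r). Qed.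

HB.instance Definition _ :=
  isSuperBimodule.Build (superEnd P) R evalBimod eval_bimodA.

End Evaluation.

(* The parity-preserving R-linear maps, i.e. the morphisms of right modules. *)
Section EvenHom.
Variables (R : superRingType) (M N : superRmodType R).

Definition even_pred : {pred superHom M N} := fun f => `[< grade false f >].

Lemma even_pred_zmod_closed : zmod_closed even_pred.
Proof.
split=> [|f g /asboolP hf /asboolP hg]; apply/asboolP; first exact: grade0.
exact: gradeB.
Qed.

HB.instance Definition _ :=
  GRing.isZmodClosed.Build (superHom M N) even_pred even_pred_zmod_closed.

Record rmodHom := RmodHom {
  rmodHom_hom :> superHom M N;
  rmodHom_in : rmodHom_hom \in even_pred }.

HB.instance Definition _ := [isSub for rmodHom_hom].
HB.instance Definition _ := [Choice of rmodHom by <:].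
HB.instance Definition _ := [SubChoice_isSubZmodule of rmodHom by <:].

Lemma rmodHom_even (f : rmodHom) : grade false (f : superHom M N).
Proof. exact/asboolP/rmodHom_in. Qed.

Definition mkRmodHom (f : M -> N) (lin_f : rlinear f)
    (even_f : forall i x, grade i x -> grade i (f x)) : rmodHom :=
  @RmodHom (mkSuperHom lin_f) (introT (asboolP _) even_f).

Lemma rmodHomP (f g : rmodHom) : (forall x, f x = g x) -> f = g.
Proof. by move=> e; apply/val_inj/superHomP. Qed.

End EvenHom.

Section RmodHomComp.
Variables (R : superRingType) (L M N : superRmodType R).

Definition rmodHom_id (X : superRmodType R) : rmodHom X X :=
  mkRmodHom (@superHom_id_lin R X) (fun i x hx => hx).

Lemma rmodHom_comp_even (g : rmodHom M N) (f : rmodHom L M) i (x : L) :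
  grade i x -> grade i (g (f x)).
Proof. by move=> hx; apply: (rmodHom_even g); exact: (rmodHom_even f). Qed.

Definition rmodHom_comp (g : rmodHom M N) (f : rmodHom L M) : rmodHom L N :=
  mkRmodHom (superHom_comp_lin g f) (@rmodHom_comp_even g f).

End RmodHomComp.

Section Progenerator.
Variables (R : superRingType).

Definition finitely_generated (P : superRmodType R) : Prop :=
  exists (n : nat) (e : 'I_n -> P), forall p : P,
    exists c : 'I_n -> R, p = \sum_(i < n) e i :* c i.

(* 0 -> A -> B -> C -> 0 is exact. *)
Definition short_exact (A B C : zmodType) (f : A -> B) (g : B -> C) : Prop :=
  [/\ injective f,
      forall y, g y = 0 <-> exists x, f x = y
    & forall z, exists y, g y = z].

(* Exactness of the functor Hom(P, -) from right modules to abelian groups. *)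
Definition projective (P : superRmodType R) : Prop :=
  forall (M1 M2 M3 : superRmodType R) (f : rmodHom M1 M2) (g : rmodHom M2 M3),
    short_exact f g ->
    short_exact (fun h : rmodHom P M1 => rmodHom_comp f h)
                (fun h : rmodHom P M2 => rmodHom_comp g h).

(* The test maps h have arbitrary parity. *)
Definition generator (P : superRmodType R) : Prop :=
  forall (M N : superRmodType R) (f : rmodHom M N),
    (forall h : superHom P M, superHom_comp f h = 0) -> f = 0.

Definition progenerator (P : superRmodType R) : Prop :=
  [/\ finitely_generated P, projective P & generator P].

End Progenerator.

Section LmodHom.
Variables (R : superRingType).

Record lmodHom (M N : superLmodType R) := LmodHom {
  lmodHom_fun :> M -> N;
  lmodHom_lin : linear lmodHom_fun;
  lmodHom_even : forall i x, grade i x -> grade i (lmodHom_fun x) }.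

Lemma lmodHomP (M N : superLmodType R) (f g : lmodHom M N) :
  (forall x, f x = g x) -> f = g.
Proof.
case: f g => [f lf ef] [g lg eg] /= /funext e; case: _ / e in lg eg *.
by congr LmodHom; exact: Prop_irrelevance.
Qed.

Definition lmodHom_id (M : superLmodType R) : lmodHom M M :=
  @LmodHom M M id (fun _ _ _ => erefl) (fun _ _ h => h).

Lemma lmodHom_comp_lin (L M N : superLmodType R) (g : lmodHom M N)
  (f : lmodHom L M) : linear (g \o f).
Proof. by move=> r u v /=; rewrite !lmodHom_lin. Qed.

Definition lmodHom_comp (L M N : superLmodType R) (g : lmodHom M N)
    (f : lmodHom L M) : lmodHom L N :=
  LmodHom (lmodHom_comp_lin g f)
    (fun i x hx => lmodHom_even g (lmodHom_even f hx)).

End LmodHom.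

Record category := Category {
  obj :> Type;
  mor : obj -> obj -> Type;
  idm : forall a, mor a a;
  compm : forall a b c, mor b c -> mor a b -> mor a c;
  comp1m : forall a b (f : mor a b), compm (idm b) f = f;
  compm1 : forall a b (f : mor a b), compm f (idm a) = f;
  compmA : forall a b c d (h : mor c d) (g : mor b c) (f : mor a b),
    compm h (compm g f) = compm (compm h g) f }.

Arguments mor {_} _ _.
Arguments idm {_} _.
Arguments compm {_ _ _ _} _ _.

Record functor (C D : category) := Functor {
  fobj :> C -> D;
  fmor : forall a b : C, mor a b -> mor (fobj a) (fobj b);
  fmor_id : forall a, fmor (idm a) = idm (fobj a);
  fmor_comp : forall a b c (g : mor b c) (f : mor a b),
    fmor (compm g f) = compm (fmor g) (fmor f) }.

Arguments fmor {C D} _ {a b} _.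

Definition functor_id (C : category) : functor C C :=
  @Functor C C id (fun _ _ f => f) (fun _ => erefl) (fun _ _ _ _ _ => erefl).

Section FunctorComp.
Variables (C D E : category) (G : functor D E) (F : functor C D).

Lemma functor_comp_id a : fmor G (fmor F (idm a)) = idm (G (F a)).
Proof. by rewrite !fmor_id. Qed.

Lemma functor_comp_comp a b c (g : mor b c) (f : mor a b) :
  fmor G (fmor F (compm g f)) = compm (fmor G (fmor F g)) (fmor G (fmor F f)).
Proof. by rewrite !fmor_comp. Qed.

Definition functor_comp : functor C E :=
  @Functor C E (fun a => G (F a)) (fun _ _ f => fmor G (fmor F f))
    functor_comp_id functor_comp_comp.

End FunctorComp.

Definition naturally_isomorphic (C D : category) (F G : functor C D) : Prop :=
  exists (t : forall a, mor (F a) (G a)) (u : forall a, mor (G a) (F a)),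
    [/\ forall a b (f : mor a b), compm (fmor G f) (t a) = compm (t b) (fmor F f),
        forall a, compm (u a) (t a) = idm (F a)
      & forall a, compm (t a) (u a) = idm (G a)].

Definition mutually_inverse_equivalences (C D : category)
    (F : functor C D) (G : functor D C) : Prop :=
  naturally_isomorphic (functor_comp G F) (functor_id C) /\
  naturally_isomorphic (functor_comp F G) (functor_id D).

Section ModuleCategories.
Variable R : superRingType.

Definition rmodCat : category.
refine (@Category (superRmodType R) (@rmodHom R) (@rmodHom_id R)
  (@rmodHom_comp R) _ _ _).
- by move=> a b f; apply: rmodHomP.
- by move=> a b f; apply: rmodHomP.
- by move=> a b c d h g f; apply: rmodHomP.
Defined.

Definition lmodCat : category.
refine (@Category (superLmodType R) (@lmodHom R) (@lmodHom_id R)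
  (@lmodHom_comp R) _ _ _).
- by move=> a b f; apply: lmodHomP.
- by move=> a b f; apply: lmodHomP.
- by move=> a b c d h g f; apply: lmodHomP.
Defined.

End ModuleCategories.

(* The subgroup generated by A. *)
Inductive zspan (V : zmodType) (A : V -> Prop) : V -> Prop :=
| zspan_gen x : A x -> zspan A x
| zspan0 : zspan A 0
| zspanB x y : zspan A x -> zspan A y -> zspan A (x - y).

Section ZspanTheory.
Variables (V : zmodType) (A : V -> Prop).

Lemma zspanN x : zspan A x -> zspan A (- x).
Proof. by move=> hx; rewrite -[- x]add0r; apply: zspanB => //; exact: zspan0. Qed.

Lemma zspanD x y : zspan A x -> zspan A y -> zspan A (x + y).
Proof. by move=> hx hy; rewrite -[y]opprK; apply: zspanB => //; exact: zspanN. Qed.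

Lemma zspanMz x (n : int) : zspan A x -> zspan A (x *~ n).
Proof.
move=> hx; have nat k : zspan A (x *+ k).
  by elim: k => [|k IH]; [exact: zspan0 | rewrite mulrS; exact: zspanD].
by case: n => k; [exact: nat | exact/zspanN/nat].
Qed.

Lemma zspan_sum (I : Type) (s : seq I) (F : I -> V) :
  (forall i, zspan A (F i)) -> zspan A (\sum_(i <- s) F i).
Proof.
move=> hF; elim: s => [|i s IH]; first by rewrite big_nil; exact: zspan0.
by rewrite big_cons; exact: zspanD.
Qed.

End ZspanTheory.

Section Tensor.
Variables (R : superRingType) (M : superRmodType R) (N : superLmodType R).

Local Notation free := {freeg (M * N) / int}.

Inductive tensor_relator : free -> Prop :=
| TensorDl m m' n :
    tensor_relator (<< (m + m', n) >> - (<< (m, n) >> + << (m', n) >>))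
| TensorDr m n n' :
    tensor_relator (<< (m, n + n') >> - (<< (m, n) >> + << (m, n') >>))
| TensorZ m (r : R) n :
    tensor_relator (<< (m :* r, n) >> - << (m, r *: n) >>).

Definition tensor_relations : {pred free} :=
  fun x => `[< zspan tensor_relator x >].

Lemma tensor_relations_zmod_closed : zmod_closed tensor_relations.
Proof.
split=> [|x y /asboolP hx /asboolP hy]; apply/asboolP; first exact: zspan0.
exact: zspanB.
Qed.

HB.instance Definition _ :=
  GRing.isZmodClosed.Build free tensor_relations tensor_relations_zmod_closed.

Definition tensor : Type := Quotient.quot tensor_relations.

HB.instance Definition _ :=
  GRing.Zmodule.copy tensor (Quotient.quot tensor_relations).

Definition tensor_pi (x : free) : tensor := \pi_(Quotient.quot tensor_relations)%qT x.

Definition tpure (m : M) (n : N) : tensor := tensor_pi << (m, n) >>.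

Lemma tensor_pi_zmod_morphism : zmod_morphism tensor_pi.
Proof. by move=> x y; rewrite /tensor_pi raddfB. Qed.

HB.instance Definition _ :=
  GRing.isZmodMorphism.Build free tensor tensor_pi tensor_pi_zmod_morphism.

Lemma tensor_pi_eq x y :
  tensor_pi x = tensor_pi y <-> zspan tensor_relator (x - y).
Proof.
split=> [e|h].
  by apply/asboolP; rewrite -[`[< _ >]]/(x - y \in tensor_relations)
    Quotient.idealrBE; apply/eqP.
by apply/eqP; rewrite /tensor_pi -Quotient.idealrBE; apply/asboolP.
Qed.

Lemma tensor_pi_surj (t : tensor) : exists x, t = tensor_pi x.
Proof. by exists (repr (t : Quotient.quot tensor_relations)); rewrite /tensor_pi reprK. Qed.

Lemma tpureDl m m' n : tpure (m + m') n = tpure m n + tpure m' n.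
Proof.
rewrite /tpure -raddfD; apply/tensor_pi_eq; apply: zspan_gen; exact: TensorDl.
Qed.

Lemma tpureDr m n n' : tpure m (n + n') = tpure m n + tpure m n'.
Proof.
rewrite /tpure -raddfD; apply/tensor_pi_eq; apply: zspan_gen; exact: TensorDr.
Qed.

Lemma tpureZ m (r : R) n : tpure (m :* r) n = tpure m (r *: n).
Proof. by apply/tensor_pi_eq; apply: zspan_gen; exact: TensorZ. Qed.

Lemma tpure0l n : tpure 0 n = 0.
Proof. by apply: (addrI (tpure 0 n)); rewrite -tpureDl !addr0. Qed.

Lemma tpure0r m : tpure m 0 = 0.
Proof. by apply: (addrI (tpure m 0)); rewrite -tpureDr !addr0. Qed.

Lemma tpureNl m n : tpure (- m) n = - tpure m n.
Proof. by apply/eqP; rewrite -addr_eq0 -tpureDl addNr tpure0l. Qed.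

Lemma tpureNr m n : tpure m (- n) = - tpure m n.
Proof. by apply/eqP; rewrite -addr_eq0 -tpureDr addNr tpure0r. Qed.

Lemma tensor_span (t : tensor) : zspan (fun x => exists m n, x = tpure m n) t.
Proof.
have [x ->] := tensor_pi_surj t; rewrite -(freeg_sumE x) raddf_sum.
apply: zspan_sum => -[m n]; rewrite -[coeff _ _]intz -freegU_mulz raddfMz.
by apply/zspanMz/zspan_gen; exists m, n.
Qed.

Lemma tensor_ind (Q : tensor -> Prop) :
  (forall m n, Q (tpure m n)) -> (forall x y, Q x -> Q y -> Q (x - y)) ->
  forall t, Q t.
Proof.
move=> Qp QB t; elim: (tensor_span t) => [_ [m [n ->]] // | | x y _ ? _ ?].
- by rewrite -(tpure0l 0).
- exact: QB.
Qed.

Section Lift.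
Variables (A : zmodType) (f : M -> N -> A).

Definition balanced : Prop :=
  [/\ forall m m' n, f (m + m') n = f m n + f m' n,
      forall m n n', f m (n + n') = f m n + f m n'
    & forall m (r : R) n, f (m :* r) n = f m (r *: n)].

Definition free_lift : free -> ssrint.zmodule A :=
  fglift (fun p : M * N => f p.1 p.2 : ssrint.zmodule A).

Lemma free_lift_zmod_morphism : zmod_morphism free_lift.
Proof. exact: lift_is_additive. Qed.

(* The group morphism induced by f; meaningful when f is balanced. *)
Definition tensor_lift (t : tensor) : A :=
  free_lift (repr (t : Quotient.quot tensor_relations)).

Hypothesis balanced_f : balanced.

Lemma tensor_lift_pi x :
  tensor_lift (tensor_pi x) = free_lift x.
Proof.
pose g := free_lift; have gB : zmod_morphism g := free_lift_zmod_morphism.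
have gD x1 y1 : g (x1 + y1) = g x1 + g y1.
  have g0 : g 0 = 0 by rewrite -(subrr 0) gB subrr.
  by rewrite -[y1 in LHS]opprK gB -[- y1]add0r gB g0 sub0r opprK.
have gU m n : g << (m, n) >> = f m n by rewrite /g /free_lift liftU scale1r.
have [fDl fDr fZ] := balanced_f.
have ker y : zspan tensor_relator y -> g y = 0.
  elim=> [_ [m m' n | m n n' | m r n] | | y1 y2 _ h1 _ h2].
  - by rewrite gB gD !gU fDl subrr.
  - by rewrite gB gD !gU fDr subrr.
  - by rewrite gB !gU fZ subrr.
  - by rewrite -(subrr 0) gB subrr.
  - by rewrite gB h1 h2 subrr.
apply/eqP; rewrite -subr_eq0 -[X in X == 0]gB; apply/eqP/ker/tensor_pi_eq.
by rewrite /tensor_pi reprK.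
Qed.

Lemma tensor_liftE m n : tensor_lift (tpure m n) = f m n.
Proof. by rewrite /tpure tensor_lift_pi /free_lift liftU scale1r. Qed.

Lemma tensor_lift_zmod_morphism : zmod_morphism tensor_lift.
Proof.
move=> s t; have [x ->] := tensor_pi_surj s; have [y ->] := tensor_pi_surj t.
by rewrite -tensor_pi_zmod_morphism !tensor_lift_pi; exact: free_lift_zmod_morphism.
Qed.

End Lift.

(* The sum of the images of M_i (x) N_j over i + j = k. *)
Definition tensor_grade (k : bool) : tensor -> Prop :=
  zspan (fun t => exists i j m n,
    [/\ grade i m, grade j n, i (+) j = k & t = tpure m n]).

Lemma tensor_grade0 k : tensor_grade k 0.
Proof. exact: zspan0. Qed.

Lemma tensor_gradeB k s t :
  tensor_grade k s -> tensor_grade k t -> tensor_grade k (s - t).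
Proof. exact: zspanB. Qed.

Lemma tpure_grade i j m n :
  grade i m -> grade j n -> tensor_grade (i (+) j) (tpure m n).
Proof. by move=> hm hn; apply: zspan_gen; exists i, j, m, n. Qed.

Definition tensor_part k : tensor -> tensor :=
  tensor_lift (fun m n =>
    tpure (part false m) (part k n) + tpure (part true m) (part (~~ k) n)).

Lemma tensor_part_balanced k : balanced (fun m n =>
    tpure (part false m) (part k n) + tpure (part true m) (part (~~ k) n)).
Proof.
split=> [m m' n | m n n' | m r n].
- by rewrite !partD !tpureDl addrACA.
- by rewrite !partD !tpureDr addrACA.
have even r0 : grade false r0 ->
    tpure (part false (m :* r0)) (part k n) +
      tpure (part true (m :* r0)) (part (~~ k) n) =
    tpure (part false m) (part k (r0 *: n)) +
      tpure (part true m) (part (~~ k) (r0 *: n)).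
  move=> h; rewrite -[false]addbF (part_ract _ _ h) -[true]addbF (part_ract _ _ h).
  rewrite -[k in RHS]addbF (part_scale _ _ h) -[~~ (k (+) _)]addbF.
  by rewrite (part_scale _ _ h) !tpureZ !addbF.
have odd r1 : grade true r1 ->
    tpure (part false (m :* r1)) (part k n) +
      tpure (part true (m :* r1)) (part (~~ k) n) =
    tpure (part false m) (part k (r1 *: n)) +
      tpure (part true m) (part (~~ k) (r1 *: n)).
  move=> h; have := part_ract true m h; have := part_ract false m h.
  rewrite /= => -> ->; have := part_scale k n h; have := part_scale (~~ k) n h.
  by rewrite !addbT negbK => -> ->; rewrite !tpureZ addrC.
rewrite -[r]part_sum ractDr scalerDl !partD !tpureDl !tpureDr.
rewrite addrACA [RHS]addrACA.
by rewrite (even _ (part_grade false r)) (odd _ (part_grade true r)).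
Qed.

Lemma tensor_part_zmod_morphism k : zmod_morphism (tensor_part k).
Proof. exact/tensor_lift_zmod_morphism/tensor_part_balanced. Qed.

Lemma tensor_partE k i j m n : grade i m -> grade j n ->
  tensor_part k (tpure m n) = if i (+) j == k then tpure m n else 0.
Proof.
move=> hm hn; rewrite /tensor_part tensor_liftE; last exact: tensor_part_balanced.
have [im jn] := (part_id hm, part_id hn).
have [zm zn] : part (~~ i) m = 0 /\ part (~~ j) n = 0.
  by split; apply: part_neg; rewrite negbK.
by case: i j k {hm hn} im jn zm zn => [] [] [] /= im jn zm zn;
  rewrite ?im ?jn ?zm ?zn ?tpure0l ?tpure0r ?addr0 ?add0r.
Qed.

Lemma tensor_part_id k t : tensor_grade k t -> tensor_part k t = t.
Proof.
elim=> [_ [i [j [m [n [hm hn e ->]]]]] | | x y _ hx _ hy].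
- by rewrite (tensor_partE _ hm hn) e eqxx.
- by rewrite -(subrr 0) tensor_part_zmod_morphism !subrr.
- by rewrite tensor_part_zmod_morphism hx hy.
Qed.

Lemma tensor_part_neg k t : tensor_grade (~~ k) t -> tensor_part k t = 0.
Proof.
elim=> [_ [i [j [m [n [hm hn e ->]]]]] | | x y _ hx _ hy].
- by rewrite (tensor_partE _ hm hn) e; case: (k).
- by rewrite -(subrr 0) tensor_part_zmod_morphism !subrr.
- by rewrite tensor_part_zmod_morphism hx hy subrr.
Qed.

Lemma tensor_grade_split t : exists t0 t1,
  [/\ tensor_grade false t0, tensor_grade true t1 & t = t0 + t1].
Proof.
elim/tensor_ind: t => [m n | x y].
  exists (tpure (part false m) (part false n) + tpure (part true m) (part true n)).
  exists (tpure (part false m) (part true n) + tpure (part true m) (part false n)).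
  split.
  - by apply: zspanD; [apply: (@tpure_grade false false) |
      apply: (@tpure_grade true true)]; exact: part_grade.
  - by apply: zspanD; [apply: (@tpure_grade false true) |
      apply: (@tpure_grade true false)]; exact: part_grade.
  rewrite -[in LHS](part_sum m) -[in LHS](part_sum n) !tpureDl !tpureDr.
  by rewrite [tpure (part true m) _ + _ in LHS]addrC addrACA.
move=> [x0 [x1 [hx0 hx1 ->]]] [y0 [y1 [hy0 hy1 ->]]].
exists (x0 - y0), (x1 - y1); split; [exact: zspanB | exact: zspanB |].
by rewrite opprD addrACA.
Qed.

Lemma tensor_grade_disjoint t :
  tensor_grade false t -> tensor_grade true t -> t = 0.
Proof.
by move=> h0 h1; rewrite -(tensor_part_id h0) (tensor_part_neg (k := false) h1).
Qed.

HB.instance Definition _ := isSuperZmodule.Build tensor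
  tensor_grade0 tensor_gradeB tensor_grade_split tensor_grade_disjoint.

End Tensor.

Lemma zmod_morphismD (U V : zmodType) (f : U -> V) :
  zmod_morphism f -> forall x y, f (x + y) = f x + f y.
Proof.
move=> fB x y; have f0 : f 0 = 0 by rewrite -(subrr 0) fB subrr.
by rewrite -[y in LHS]opprK fB -[- y]add0r fB f0 sub0r opprK.
Qed.

Lemma tensor_ext (R : superRingType) (M : superRmodType R) (N : superLmodType R)
    (A : zmodType) (f g : tensor M N -> A) :
  zmod_morphism f -> zmod_morphism g ->
  (forall m n, f (tpure m n) = g (tpure m n)) -> forall t, f t = g t.
Proof.
move=> fB gB e; elim/tensor_ind => // x y hx hy.
by rewrite fB gB hx hy.
Qed.

Section TensorMap.
Variables (R : superRingType).
Variables (M M' : superRmodType R) (N N' : superLmodType R).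
Variables (f : M -> M') (g : N -> N').

(* The map induced by f and g; meaningful when both are R-linear. *)
Definition tensor_map : tensor M N -> tensor M' N' :=
  tensor_lift (fun m n => tpure (f m) (g n)).

Hypotheses (lin_f : rlinear f) (lin_g : linear g).

Let gD u v : g (u + v) = g u + g v.
Proof. by have := lin_g 1 u v; rewrite !scale1r. Qed.

Let gZ (r : R) v : g (r *: v) = r *: g v.
Proof.
have g0 : g 0 = 0 by apply: (addrI (g 0)); rewrite -gD !addr0.
by have := lin_g r v 0; rewrite g0 !addr0.
Qed.

Lemma tensor_map_balanced : balanced (fun m n => tpure (f m) (g n)).
Proof.
split=> [m m' n | m n n' | m r n].
- by rewrite (rlinearD lin_f) tpureDl.
- by rewrite gD tpureDr.
- by rewrite (rlinearZ lin_f) gZ tpureZ.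
Qed.

Lemma tensor_mapE m n : tensor_map (tpure m n) = tpure (f m) (g n).
Proof. exact: tensor_liftE tensor_map_balanced m n. Qed.

Lemma tensor_map_zmod_morphism : zmod_morphism tensor_map.
Proof. exact: tensor_lift_zmod_morphism tensor_map_balanced. Qed.

Lemma tensor_map_grade a b :
  (forall i m, grade i m -> grade (i (+) a) (f m)) ->
  (forall j n, grade j n -> grade (b (+) j) (g n)) ->
  forall k t, grade k t -> grade ((a (+) b) (+) k) (tensor_map t).
Proof.
move=> hf hg k t; elim=> [_ [i [j [m [n [hm hn <- ->]]]]] | | x y _ hx _ hy].
- rewrite tensor_mapE; have := tpure_grade (hf _ _ hm) (hg _ _ hn).
  by rewrite [b (+) j]addbC addbACA addbC.
- have := tensor_map_zmod_morphism 0 0; rewrite !subrr => ->; exact: grade0.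
- by rewrite tensor_map_zmod_morphism; exact: gradeB.
Qed.

End TensorMap.

Section TensorRight.
Variables (R S : superRingType) (M : superRmodType R) (Q : superBimodType R S).

Definition tensor_ract (t : tensor M Q) (s : S) : tensor M Q :=
  tensor_map id (fun q : Q => q :* s) t.

Lemma ract_linear (s : S) : linear (fun q : Q => q :* s).
Proof. by move=> r u v; rewrite ractDl bimodA. Qed.

Lemma tensor_ractE m q s : tensor_ract (tpure m q) s = tpure m (q :* s).
Proof. by rewrite /tensor_ract tensor_mapE //; exact: ract_linear. Qed.

Lemma tensor_ractB s : zmod_morphism (tensor_ract^~ s).
Proof. by apply: tensor_map_zmod_morphism => //; exact: ract_linear. Qed.

Lemma tensor_ractA t a b :
  tensor_ract (tensor_ract t a) b = tensor_ract t (a * b).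
Proof.
elim/tensor_ind: t => [m q | x y hx hy]; first by rewrite !tensor_ractE ractA.
by rewrite !tensor_ractB hx hy.
Qed.

Lemma tensor_ract1 t : tensor_ract t 1 = t.
Proof.
elim/tensor_ind: t => [m q | x y hx hy]; first by rewrite tensor_ractE ract1.
by rewrite tensor_ractB hx hy.
Qed.

Lemma tensor_ractDl t u a :
  tensor_ract (t + u) a = tensor_ract t a + tensor_ract u a.
Proof. exact: (zmod_morphismD (tensor_ractB a)). Qed.

Lemma tensor_ractDr t a b :
  tensor_ract t (a + b) = tensor_ract t a + tensor_ract t b.
Proof.
elim/tensor_ind: t => [m q | x y hx hy].
  by rewrite !tensor_ractE ractDr tpureDr.
by rewrite !tensor_ractB hx hy opprD addrACA.
Qed.

Lemma tensor_ract_grade i j (t : tensor M Q) (s : S) :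
  grade i t -> grade j s -> grade (i (+) j) (tensor_ract t s).
Proof.
move=> ht hs; rewrite addbC -[j]addFb.
apply: (tensor_map_grade (f := id)) ht => //; first exact: ract_linear.
  by move=> k m; rewrite addbF.
by move=> k n hn; rewrite addbC; exact: grade_ract.
Qed.

HB.instance Definition _ := isSuperRmodule.Build S (tensor M Q)
  tensor_ractA tensor_ract1 tensor_ractDl tensor_ractDr tensor_ract_grade.

End TensorRight.

Section TensorLeft.
Variables (R S : superRingType) (P : superBimodType S R) (N : superLmodType R).

Definition tensor_scale (s : S) (t : tensor P N) : tensor P N :=
  tensor_map (fun p : P => s *: p) id t.

Lemma scale_rlinear (s : S) : rlinear (fun p : P => s *: p).
Proof. by move=> r u v; rewrite scalerDr bimodA. Qed.

Lemma tensor_scaleE s p n : tensor_scale s (tpure p n) = tpure (s *: p) n.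
Proof. by rewrite /tensor_scale tensor_mapE //; exact: scale_rlinear. Qed.

Lemma tensor_scaleB s : zmod_morphism (tensor_scale s).
Proof. by apply: tensor_map_zmod_morphism => //; exact: scale_rlinear. Qed.

Lemma tensor_scaleA a b t :
  tensor_scale a (tensor_scale b t) = tensor_scale (a * b) t.
Proof.
elim/tensor_ind: t => [p n | x y hx hy]; first by rewrite !tensor_scaleE scalerA.
by rewrite !tensor_scaleB hx hy.
Qed.

Lemma tensor_scale1 : left_id 1 tensor_scale.
Proof.
elim/tensor_ind=> [p n | x y hx hy]; first by rewrite tensor_scaleE scale1r.
by rewrite tensor_scaleB hx hy.
Qed.

Lemma tensor_scaleDr : right_distributive tensor_scale +%R.
Proof. by move=> s; exact: (zmod_morphismD (tensor_scaleB s)). Qed.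

Lemma tensor_scaleDl t : {morph tensor_scale^~ t : a b / a + b}.
Proof.
move=> a b; elim/tensor_ind: t => [p n | x y hx hy].
  by rewrite !tensor_scaleE scalerDl tpureDl.
by rewrite !tensor_scaleB hx hy opprD addrACA.
Qed.

HB.instance Definition _ := GRing.Zmodule_isLmodule.Build S (tensor P N)
  tensor_scaleA tensor_scale1 tensor_scaleDr tensor_scaleDl.

Lemma tensor_scale_grade i j (s : S) (t : tensor P N) :
  grade i s -> grade j t -> grade (i (+) j) (s *: t).
Proof.
move=> hs ht; rewrite -[i]addbF.
apply: (tensor_map_grade (g := id)) ht => //; first exact: scale_rlinear.
by move=> k m hm; rewrite addbC; exact: gradeZ.
Qed.

HB.instance Definition _ :=
  isSuperLmodule.Build S (tensor P N) tensor_scale_grade.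

End TensorLeft.

Section TensorFunctorRight.
Variables (R S : superRingType) (Q : superBimodType R S).

Lemma tensorR_lin (M N : superRmodType R) (f : rmodHom M N) :
  rlinear (tensor_map f id : tensor M Q -> tensor N Q).
Proof.
have lf := superHom_lin f; have li : linear (@id Q) by [].
have fB := tensor_map_zmod_morphism lf li.
move=> s t u; rewrite (zmod_morphismD fB); congr (_ + _).
elim/tensor_ind: t => [m q | x y hx hy].
  by rewrite /ract /= !tensor_ractE !tensor_mapE //= /ract /= tensor_ractE.
by rewrite ractBl !fB ractBl hx hy.
Qed.

Lemma tensorR_even (M N : superRmodType R) (f : rmodHom M N) i (t : tensor M Q) :
  grade i t -> grade i (tensor_map f id t : tensor N Q).
Proof.
apply: (@tensor_map_grade _ _ _ _ _ _ _ _ _ false false) => //.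
- exact: superHom_lin.
- by move=> j m hm; rewrite addbF; exact: (rmodHom_even f).
Qed.

Definition tensorR_mor (M N : superRmodType R) (f : rmodHom M N) :
    rmodHom (tensor M Q) (tensor N Q) :=
  mkRmodHom (@tensorR_lin M N f) (@tensorR_even M N f).

(* The functor - (x)_R Q from right R-modules to right S-modules. *)
Definition tensorR : functor (rmodCat R) (rmodCat S).
refine (@Functor (rmodCat R) (rmodCat S)
  (fun M : superRmodType R => tensor M Q : superRmodType S) tensorR_mor _ _).
- move=> M; apply: rmodHomP; apply: tensor_ext => //.
    exact: tensor_map_zmod_morphism.
  by move=> m q; rewrite /= tensor_mapE.
- move=> L M N g f; apply: rmodHomP; apply: tensor_ext.
  + apply: tensor_map_zmod_morphism => //; exact: superHom_comp_lin.
  + move=> x y /=; rewrite !tensor_map_zmod_morphism //; exact: superHom_lin.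
  + move=> m q /=; rewrite !tensor_mapE //; try exact: superHom_lin.
    exact: superHom_comp_lin.
Defined.

End TensorFunctorRight.

Section TensorFunctorLeft.
Variables (R S : superRingType) (P : superBimodType S R).

Lemma tensorL_lin (M N : superLmodType R) (f : lmodHom M N) :
  linear (tensor_map id f : tensor P M -> tensor P N).
Proof.
have lf := lmodHom_lin f; have li : rlinear (@id P) by [].
have fB := tensor_map_zmod_morphism li lf.
move=> s t u; rewrite (zmod_morphismD fB); congr (_ + _).
elim/tensor_ind: t => [m q | x y hx hy].
  by rewrite -[s *: _]/(tensor_scale s _) -[RHS]/(tensor_scale s _)
    tensor_scaleE !tensor_mapE // tensor_scaleE.
by rewrite scalerBr !fB scalerBr hx hy.
Qed.

Lemma tensorL_even (M N : superLmodType R) (f : lmodHom M N) i (t : tensor P M) :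
  grade i t -> grade i (tensor_map id f t : tensor P N).
Proof.
apply: (@tensor_map_grade _ _ _ _ _ _ _ _ _ false false) => //.
- exact: lmodHom_lin.
- by move=> j m hm; rewrite addbF.
- by move=> j m hm; exact: (lmodHom_even f).
Qed.

Definition tensorL_mor (M N : superLmodType R) (f : lmodHom M N) :
    lmodHom (tensor P M) (tensor P N) :=
  LmodHom (@tensorL_lin M N f) (@tensorL_even M N f).

(* The functor P (x)_R - from left R-modules to left S-modules. *)
Definition tensorL : functor (lmodCat R) (lmodCat S).
refine (@Functor (lmodCat R) (lmodCat S)
  (fun N : superLmodType R => tensor P N : superLmodType S) tensorL_mor _ _).
- move=> M; apply: lmodHomP; apply: tensor_ext => //.
    exact: tensor_map_zmod_morphism.
  by move=> m q; rewrite /= tensor_mapE.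
- move=> L M N g f; apply: lmodHomP; apply: tensor_ext.
  + apply: tensor_map_zmod_morphism => //; exact: lmodHom_comp_lin.
  + move=> x y /=; rewrite !tensor_map_zmod_morphism //; exact: lmodHom_lin.
  + move=> m q /=; rewrite !tensor_mapE //; try exact: lmodHom_lin.
    exact: lmodHom_comp_lin.
Defined.

End TensorFunctorLeft.

(* Main.v *)
Require Import Defs.
From HB Require Import structures.
From mathcomp Require Import all_boot all_algebra.
From mathcomp Require Import boolp functions.

(* Evaluation (q, p) |-> q p and the rank one maps (p, q) |-> p q(-) are even
   pairings Q x P -> R and P x Q -> S, related by (p q) p' = p (q p') and
   q (p q') = (q p) q'.  If 1 = sum_i mu(q_i, p_i) for one of them, then
   m (x) q (x) p |-> m mu(q, p) has inverse m |-> sum_i m (x) q_i (x) p_i.  Such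
   an expression of 1 exists in R because the map R -> R / trace(P) kills every
   map P -> R, so it vanishes as P is a generator; it exists in S by splitting
   an even presentation of P by a free module with degree shifts (dual basis). *)

Set Implicit Arguments.
Unset Strict Implicit.
Unset Printing Implicit Defensive.

Import GRing.Theory.
Local Open Scope ring_scope.

(** * Additive maps and parity *)

Lemma zmod_morphism0 (U V : zmodType) (f : U -> V) : zmod_morphism f -> f 0 = 0.
Proof. by move=> fB; rewrite -(subrr 0) fB subrr. Qed.

(** The map [f] sends [g y - part i (g y)] to an element of degree [~~ i] that also equals
    [y - f (part i (g y))], of degree [i]. It therefore vanishes, and injectivity of [f] gives
    [g y = part i (g y)]. *)
Lemma part_can_even (U V : superZmodType) (f : U -> V) (g : V -> U) :
  zmod_morphism f -> (forall i x, grade i x -> grade i (f x)) ->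
  cancel f g -> cancel g f -> forall i y, grade i y -> grade i (g y).
Proof.
move=> fB f_even fK gK i y hy.
suff <- : part i (g y) = g y by exact: part_grade.
apply: (can_inj fK); rewrite gK -[y]gK -[X in _ = f X](subrK (part i (g y))).
rewrite gK (zmod_morphismD fB) [X in X + _](@grade_disj _ i) ?add0r //.
  by rewrite fB gK; apply: gradeB => //; apply: f_even; exact: part_grade.
by apply: f_even; exact: part_compl.
Qed.

(** * Natural isomorphisms from pointwise inverses *)

Section InverseHom.
Variable R : superRingType.

(** Linearity of [g] can be tested after applying the injective map [f], and parity comes from
    [part_can_even]. Thus a bare inverse function suffices to invert a morphism. *)
Lemma rmodHom_can (M N : superRmodType R) (f : rmodHom M N) (g : N -> M) :
  cancel f g -> cancel g f -> exists h : rmodHom N M, h =1 g.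
Proof.
move=> fK gK; have lin_f := superHom_lin f.
have lin_g : rlinear g.
  by move=> r u v; apply: (can_inj fK); rewrite lin_f !gK.
have even_g := part_can_even (rlinearB lin_f) (rmodHom_even f) fK gK.
by exists (mkRmodHom lin_g even_g).
Qed.

Lemma lmodHomB (M N : superLmodType R) (f : lmodHom M N) : zmod_morphism f.
Proof. by move=> u v; rewrite addrC -scaleN1r lmodHom_lin scaleN1r addrC. Qed.

Lemma lmodHomZ (M N : superLmodType R) (f : lmodHom M N) r u :
  f (r *: u) = r *: f u.
Proof.
by rewrite -[X in f X]addr0 lmodHom_lin (zmod_morphism0 (lmodHomB f)) addr0.
Qed.

Lemma lmodHom_can (M N : superLmodType R) (f : lmodHom M N) (g : N -> M) :
  cancel f g -> cancel g f -> exists h : lmodHom N M, h =1 g.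
Proof.
move=> fK gK; have lin_f := lmodHom_lin f.
have lin_g : linear g.
  by move=> r u v; apply: (can_inj fK); rewrite lin_f !gK.
have even_g := part_can_even (lmodHomB f) (@lmodHom_even _ _ _ f) fK gK.
by exists (LmodHom lin_g even_g).
Qed.

(** This reduces a natural isomorphism to identities between elements: the inverses [u a] are plain
    functions, and [rmodHom_can] promotes each of them to a morphism. *)
Lemma rmod_naturally_isomorphic (C : category) (F G : functor C (rmodCat R))
    (t : forall a, rmodHom (F a) (G a))
    (u : forall a, (G a : superRmodType R) -> (F a : superRmodType R)) :
  (forall a b (f : mor a b) x,
     (fmor G f : rmodHom _ _) (t a x) = t b ((fmor F f : rmodHom _ _) x)) ->
  (forall a, cancel (t a) (u a)) -> (forall a, cancel (u a) (t a)) ->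
  naturally_isomorphic F G.
Proof.
move=> nat tK uK.
pose v a := cid (rmodHom_can (@tK a) (@uK a)).
exists t, (fun a => projT1 (v a)); split=> [a b f | a | a]; apply: rmodHomP => x /=.
- exact: nat.
- by rewrite (projT2 (v a)) tK.
- by rewrite (projT2 (v a)) uK.
Qed.

Lemma lmod_naturally_isomorphic (C : category) (F G : functor C (lmodCat R))
    (t : forall a, lmodHom (F a) (G a))
    (u : forall a, (G a : superLmodType R) -> (F a : superLmodType R)) :
  (forall a b (f : mor a b) x,
     (fmor G f : lmodHom _ _) (t a x) = t b ((fmor F f : lmodHom _ _) x)) ->
  (forall a, cancel (t a) (u a)) -> (forall a, cancel (u a) (t a)) ->
  naturally_isomorphic F G.
Proof.
move=> nat tK uK.
pose v a := cid (lmodHom_can (@tK a) (@uK a)).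
exists t, (fun a => projT1 (v a)); split=> [a b f | a | a]; apply: lmodHomP => x /=.
- exact: nat.
- by rewrite (projT2 (v a)) tK.
- by rewrite (projT2 (v a)) uK.
Qed.

End InverseHom.

Lemma tpureBl (R : superRingType) (M : superRmodType R) (N : superLmodType R)
    (m m' : M) (n : N) : tpure (m - m') n = tpure m n - tpure m' n.
Proof. by rewrite tpureDl tpureNl. Qed.

Lemma tpureBr (R : superRingType) (M : superRmodType R) (N : superLmodType R)
    (m : M) (n n' : N) : tpure m (n - n') = tpure m n - tpure m n'.
Proof. by rewrite tpureDr tpureNr. Qed.

(** * Morita contexts *)

(** An even morphism of (A, A)-bimodules from the tensor product of Q and P over B to A, written as
    a balanced map of two variables. *)
Record super_pairing (A B : superRingType) (Q : superBimodType A B)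
    (P : superBimodType B A) (mu : Q -> P -> A) : Prop := SuperPairing {
  pairingDl : forall q q' p, mu (q + q') p = mu q p + mu q' p;
  pairingDr : forall q p p', mu q (p + p') = mu q p + mu q p';
  pairingZl : forall a q p, mu (a *: q) p = a * mu q p;
  pairingZr : forall q p a, mu q (p :* a) = mu q p * a;
  pairingA : forall q b p, mu (q :* b) p = mu q (b *: p);
  pairing_grade : forall i j q p,
    grade i q -> grade j p -> grade (i (+) j) (mu q p) }.

Section MoritaContext.
Variables (A B : superRingType) (Q : superBimodType A B) (P : superBimodType B A).
Variables (mu : Q -> P -> A) (nu : P -> Q -> B).
Hypotheses (mu_pairing : super_pairing mu).
Hypotheses (mu_nu : forall q p q', mu q p *: q' = q :* nu p q')
  (nu_mu : forall p q p', nu p q *: p' = p :* mu q p').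
Variables (n : nat) (q_ : 'I_n -> Q) (p_ : 'I_n -> P).
Hypothesis mu1 : \sum_i mu (q_ i) (p_ i) = 1.

(** * Contraction and expansion for right modules *)

Section Right.
Variable M : superRmodType A.

(** The contraction of a triple tensor needs two lifts: this one over (m, q) with [p] fixed, then
    one over the resulting tensor and [p]. *)
Definition contract_rr (p : P) : tensor M Q -> M :=
  tensor_lift (fun m q => m :* mu q p).

Lemma contract_rr_balanced p : balanced (fun (m : M) q => m :* mu q p).
Proof.
split=> [m m' q | m q q' | m r q]; first exact: ractDl.
  by rewrite (pairingDl mu_pairing) ractDr.
by rewrite (pairingZl mu_pairing) ractA.
Qed.

Lemma contract_rrE p m q : contract_rr p (tpure m q) = m :* mu q p.
Proof. exact: tensor_liftE (contract_rr_balanced p) m q. Qed.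

Lemma contract_rrB p : zmod_morphism (contract_rr p).
Proof. exact: tensor_lift_zmod_morphism (contract_rr_balanced p). Qed.

Definition contract_r : tensor (tensor M Q) P -> M :=
  tensor_lift (fun t p => contract_rr p t).

(** Balancedness over B is the associativity [pairingA], checked on pure tensors of the inner
    product. *)
Lemma contract_r_balanced : balanced (fun t p => contract_rr p t).
Proof.
split=> [t t' p | t p p' | t b p].
- exact: (zmod_morphismD (contract_rrB p)).
- elim/tensor_ind: t => [m q | x y hx hy].
    by rewrite !contract_rrE (pairingDr mu_pairing) ractDr.
  by rewrite !contract_rrB hx hy opprD addrACA.
- elim/tensor_ind: t => [m q | x y hx hy].
    by rewrite /ract /= tensor_ractE !contract_rrE (pairingA mu_pairing).
  by rewrite ractBl !contract_rrB hx hy.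
Qed.

Lemma contract_rE m q p : contract_r (tpure (tpure m q) p) = m :* mu q p.
Proof.
by rewrite /contract_r (tensor_liftE contract_r_balanced) contract_rrE.
Qed.

Lemma contract_rB : zmod_morphism contract_r.
Proof. exact: tensor_lift_zmod_morphism contract_r_balanced. Qed.

Lemma tensor2r_tpureB (t t' : tensor M Q) p :
  tpure (t - t') p = tpure t p - tpure t' p :> tensor (tensor M Q) P.
Proof. exact: tpureBl. Qed.

(** A pure outer tensor [tpure t p] is additive in [t], so a second induction, on [t], reaches the
    triple pure tensors. *)
Lemma tensor2r_ind (T : tensor (tensor M Q) P -> Prop) :
  (forall m q p, T (tpure (tpure m q) p)) ->
  (forall x y, T x -> T y -> T (x - y)) -> forall t, T t.
Proof.
move=> Tp TB; elim/tensor_ind=> // t p.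
elim/tensor_ind: t => // x y hx hy.
by rewrite tensor2r_tpureB; exact: TB.
Qed.

Lemma contract_r_lin : rlinear contract_r.
Proof.
move=> a u v; rewrite (zmod_morphismD contract_rB); congr (_ + _).
elim/tensor2r_ind: u => [m q p | x y hx hy].
  by rewrite {1}/ract /= tensor_ractE !contract_rE (pairingZr mu_pairing) ractA.
by rewrite ractBl !contract_rB ractBl hx hy.
Qed.

(** Degrees in a tensor product are spans of homogeneous pure tensors, hence one induction for each
    of the two nested products. *)
Lemma contract_r_grade i t : grade i t -> grade i (contract_r t).
Proof.
elim=> [_ [j [k [t' [p [ht hp <- ->]]]]] | | x y _ hx _ hy].
- elim: ht => [_ [a [b [m [q [hm hq <- ->]]]]] | | x y _ hx _ hy].
  + rewrite contract_rE -addbA; apply: grade_ract => //.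
    exact: (pairing_grade mu_pairing).
  + by rewrite tpure0l (zmod_morphism0 contract_rB); exact: grade0.
  + by rewrite tensor2r_tpureB contract_rB; exact: gradeB.
- by rewrite (zmod_morphism0 contract_rB); exact: grade0.
- by rewrite contract_rB; exact: gradeB.
Qed.

Definition contract_r_hom : rmodHom (tensor (tensor M Q) P) M :=
  mkRmodHom contract_r_lin contract_r_grade.

Definition expand_r (m : M) : tensor (tensor M Q) P :=
  \sum_i tpure (tpure m (q_ i)) (p_ i).

Lemma expand_rB : zmod_morphism expand_r.
Proof.
move=> m m'; rewrite -sumrB; apply: eq_bigr => i _.
by rewrite tpureBl tensor2r_tpureB.
Qed.

Lemma expand_rK : cancel expand_r contract_r.
Proof.
move=> m; rewrite -[RHS]ract1 -mu1.
have mD : {morph ract m : a b / a + b} by move=> a b; exact: ractDr.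
have m0 : ract m 0 = 0 by rewrite -(subrr 0) ractBr subrr.
rewrite (big_morph _ mD m0).
rewrite (big_morph _ (zmod_morphismD contract_rB) (zmod_morphism0 contract_rB)).
by apply: eq_bigr => i _; rewrite contract_rE.
Qed.

(** The scalar travels across both tensor signs: m mu(q, p) (x) q_i (x) p_i = m (x) q nu(p, q_i) (x)
    p_i = m (x) q (x) p mu(q_i, p_i). Summing over i leaves p in the last factor. *)
Lemma contract_rK : cancel contract_r expand_r.
Proof.
elim/tensor2r_ind=> [m q p | x y hx hy]; last first.
  by rewrite contract_rB expand_rB hx hy.
rewrite contract_rE.
transitivity (\sum_i tpure (tpure m q) (p :* mu (q_ i) (p_ i))).
  apply: eq_bigr => i _.
  rewrite (tpureZ m) mu_nu -(tensor_ractE m) -nu_mu.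
  exact: (@tpureZ _ (tensor M Q)).
have tD : {morph (fun a => tpure (tpure m q) (p :* a)) : a b / a + b}.
  by move=> a b; rewrite ractDr tpureDr.
have t0 : tpure (tpure m q) (p :* 0) = 0.
  by rewrite -(subrr 0) ractBr subrr tpure0r.
by rewrite -(big_morph _ tD t0) mu1 ract1.
Qed.

End Right.

(** Naturality on pure tensors is the A-linearity of the morphism. Exchanging the roles of (A, Q,
    mu) and (B, P, nu) yields the isomorphism for the other composite. *)
Lemma tensorR_can : naturally_isomorphic
  (functor_comp (tensorR P) (tensorR Q)) (functor_id (rmodCat A)).
Proof.
apply: (@rmod_naturally_isomorphic _ _
  (functor_comp (tensorR P) (tensorR Q)) (functor_id (rmodCat A))
  contract_r_hom expand_r); [ | exact: contract_rK | exact: expand_rK].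
move=> M N f; elim/tensor2r_ind=> [m q p | x y hx hy].
  rewrite /= (tensor_mapE (superHom_lin (tensorR_mor Q f))) //.
  rewrite /= (tensor_mapE (superHom_lin f)) // !contract_rE.
  exact: (rlinearZ (superHom_lin f)).
rewrite !(rlinearB (superHom_lin _)); congr (_ - _); [exact: hx | exact: hy].
Qed.

(** * Contraction and expansion for left modules *)

Section Left.
Variable N : superLmodType A.

Definition contract_ll (q : Q) : tensor P N -> N :=
  tensor_lift (fun p x => mu q p *: x).

Lemma contract_ll_balanced q : balanced (fun p (x : N) => mu q p *: x).
Proof.
split=> [p p' x | p x x' | p r x]; last by rewrite (pairingZr mu_pairing) scalerA.
  by rewrite (pairingDr mu_pairing) scalerDl.
exact: scalerDr.
Qed.

Lemma contract_llE q p x : contract_ll q (tpure p x) = mu q p *: x.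
Proof. exact: tensor_liftE (contract_ll_balanced q) p x. Qed.

Lemma contract_llB q : zmod_morphism (contract_ll q).
Proof. exact: tensor_lift_zmod_morphism (contract_ll_balanced q). Qed.

Definition contract_l : tensor Q (tensor P N) -> N := tensor_lift contract_ll.

Lemma contract_l_balanced : balanced contract_ll.
Proof.
split=> [q q' t | q t t' | q b t].
- elim/tensor_ind: t => [p x | x y hx hy].
    by rewrite !contract_llE (pairingDl mu_pairing) scalerDl.
  by rewrite !contract_llB hx hy opprD addrACA.
- exact: (zmod_morphismD (contract_llB q)).
- elim/tensor_ind: t => [p x | x y hx hy].
    rewrite -[b *: _]/(tensor_scale b _) tensor_scaleE !contract_llE.
    by rewrite (pairingA mu_pairing).
  by rewrite scalerBr !contract_llB hx hy.
Qed.

Lemma contract_lE q p x : contract_l (tpure q (tpure p x)) = mu q p *: x.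
Proof.
by rewrite /contract_l (tensor_liftE contract_l_balanced) contract_llE.
Qed.

Lemma contract_lB : zmod_morphism contract_l.
Proof. exact: tensor_lift_zmod_morphism contract_l_balanced. Qed.

Lemma tensor2l_tpureB q (t t' : tensor P N) :
  tpure q (t - t') = tpure q t - tpure q t' :> tensor Q (tensor P N).
Proof. exact: tpureBr. Qed.

Lemma tensor2l_ind (T : tensor Q (tensor P N) -> Prop) :
  (forall q p x, T (tpure q (tpure p x))) ->
  (forall x y, T x -> T y -> T (x - y)) -> forall t, T t.
Proof.
move=> Tp TB; elim/tensor_ind=> // q t.
elim/tensor_ind: t => // x y hx hy.
by rewrite tensor2l_tpureB; exact: TB.
Qed.

Lemma contract_l_lin : linear contract_l.
Proof.
move=> a u v; rewrite (zmod_morphismD contract_lB); congr (_ + _).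
elim/tensor2l_ind: u => [q p x | x y hx hy].
  rewrite -[a *: tpure _ _]/(tensor_scale a _) tensor_scaleE !contract_lE.
  by rewrite (pairingZl mu_pairing) scalerA.
by rewrite scalerBr !contract_lB scalerBr hx hy.
Qed.

Lemma contract_l_grade i t : grade i t -> grade i (contract_l t).
Proof.
elim=> [_ [j [k [q [t' [hq ht <- ->]]]]] | | x y _ hx _ hy].
- elim: ht => [_ [a [b [p [x [hp hx <- ->]]]]] | | x y _ hx _ hy].
  + rewrite contract_lE addbA; apply: gradeZ => //.
    exact: (pairing_grade mu_pairing).
  + by rewrite tpure0r (zmod_morphism0 contract_lB); exact: grade0.
  + by rewrite tensor2l_tpureB contract_lB; exact: gradeB.
- by rewrite (zmod_morphism0 contract_lB); exact: grade0.
- by rewrite contract_lB; exact: gradeB.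
Qed.

Definition contract_l_hom : lmodHom (tensor Q (tensor P N)) N :=
  LmodHom contract_l_lin contract_l_grade.

Definition expand_l (x : N) : tensor Q (tensor P N) :=
  \sum_i tpure (q_ i) (tpure (p_ i) x).

Lemma expand_lB : zmod_morphism expand_l.
Proof.
move=> m m'; rewrite -sumrB; apply: eq_bigr => i _.
by rewrite tpureBr tensor2l_tpureB.
Qed.

Lemma expand_lK : cancel expand_l contract_l.
Proof.
move=> x; rewrite -[RHS]scale1r -mu1 scaler_suml.
rewrite (big_morph _ (zmod_morphismD contract_lB) (zmod_morphism0 contract_lB)).
by apply: eq_bigr => i _; rewrite contract_lE.
Qed.

(** Mirror image of the right case: q_i (x) p_i (x) mu(q, p) x = q_i (x) nu(p_i, q) p (x) x =
    mu(q_i, p_i) q (x) p (x) x, and the sum over i leaves q in the first factor. *)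
Lemma contract_lK : cancel contract_l expand_l.
Proof.
elim/tensor2l_ind=> [q p x | x y hx hy]; last first.
  by rewrite contract_lB expand_lB hx hy.
rewrite contract_lE.
transitivity (\sum_i tpure (mu (q_ i) (p_ i) *: q) (tpure p x)).
  apply: eq_bigr => i _.
  rewrite -(tpureZ (p_ i)) -nu_mu -(tensor_scaleE _ _ x) mu_nu.
  by rewrite (@tpureZ _ Q (tensor P N)).
have tD : {morph (fun y : Q => tpure y (tpure p x)) : y z / y + z}.
  by move=> y z; exact: (@tpureDl _ Q (tensor P N)).
by rewrite -(big_morph _ tD (tpure0l _ _)) -scaler_suml mu1 scale1r.
Qed.

End Left.

Lemma tensorL_can : naturally_isomorphic
  (functor_comp (tensorL Q) (tensorL P)) (functor_id (lmodCat A)).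
Proof.
apply: (@lmod_naturally_isomorphic _ _
  (functor_comp (tensorL Q) (tensorL P)) (functor_id (lmodCat A))
  contract_l_hom expand_l); [ | exact: contract_lK | exact: expand_lK].
move=> M N f; elim/tensor2l_ind=> [q p x | x y hx hy].
  rewrite /= tensor_mapE //; last exact: (lmodHom_lin (tensorL_mor P f)).
  by rewrite /= (tensor_mapE _ (lmodHom_lin f)) // !contract_lE lmodHomZ.
by rewrite !lmodHomB; congr (_ - _); [exact: hx | exact: hy].
Qed.

End MoritaContext.

(** * Projectivity and dual bases *)

(* The free module on I; [d k] is the degree of the basis vector [k]. *)
Definition shifted_free (R : superRingType) (I : Type) (d : I -> bool) : Type :=
  I -> R.

Section ShiftedFree.
Variables (R : superRingType) (I : Type) (d : I -> bool).

Local Notation shifted_free := (shifted_free R d).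

HB.instance Definition _ := GRing.Zmodule.copy shifted_free (I -> R).

(** With this shift the vector with 1 at [k] and 0 elsewhere has degree [d k], because 1 is even. *)
Definition shifted_free_grade (i : bool) (v : shifted_free) : Prop :=
  forall k, grade (i (+) d k) (v k).

Lemma shifted_free_grade0 i : shifted_free_grade i 0.
Proof. by move=> k; exact: grade0. Qed.

Lemma shifted_free_gradeB i u v :
  shifted_free_grade i u -> shifted_free_grade i v ->
  shifted_free_grade i (u - v).
Proof. by move=> hu hv k; exact: gradeB (hu k) (hv k). Qed.

Lemma shifted_free_grade_split v : exists v0 v1,
  [/\ shifted_free_grade false v0, shifted_free_grade true v1 & v = v0 + v1].
Proof.
exists (fun k => part (d k) (v k)), (fun k => part (~~ d k) (v k)).
split=> [k | k | ]; [exact: part_grade | exact: part_grade |].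
apply/funext => k; rewrite -[LHS](part_sum (v k)) -[RHS]/(_ + _).
by case: (d k) => //=; rewrite addrC.
Qed.

Lemma shifted_free_grade_disjoint v :
  shifted_free_grade false v -> shifted_free_grade true v -> v = 0.
Proof. by move=> h0 h1; apply/funext => k; exact: grade_disj (h0 k) (h1 k). Qed.

HB.instance Definition _ := isSuperZmodule.Build shifted_free
  shifted_free_grade0 shifted_free_gradeB
  shifted_free_grade_split shifted_free_grade_disjoint.

Definition shifted_free_ract (v : shifted_free) (r : R) : shifted_free :=
  fun k => v k * r.

Lemma shifted_free_ractA v a b :
  shifted_free_ract (shifted_free_ract v a) b = shifted_free_ract v (a * b).
Proof. by apply/funext => k; exact: esym (mulrA _ _ _). Qed.

Lemma shifted_free_ract1 v : shifted_free_ract v 1 = v.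
Proof. by apply/funext => k; exact: mulr1. Qed.

Lemma shifted_free_ractDl u v a :
  shifted_free_ract (u + v) a = shifted_free_ract u a + shifted_free_ract v a.
Proof. by apply/funext => k; exact: mulrDl. Qed.

Lemma shifted_free_ractDr v a b :
  shifted_free_ract v (a + b) = shifted_free_ract v a + shifted_free_ract v b.
Proof. by apply/funext => k; exact: mulrDr. Qed.

Lemma shifted_free_grade_ract i j v a :
  grade i v -> grade j a -> grade (i (+) j) (shifted_free_ract v a).
Proof. by move=> hv ha k; rewrite addbAC; exact: gradeM (hv k) ha. Qed.

HB.instance Definition _ := isSuperRmodule.Build R shifted_free
  shifted_free_ractA shifted_free_ract1 shifted_free_ractDl shifted_free_ractDr
  shifted_free_grade_ract.

End ShiftedFree.

(** * Kernels of even morphisms *)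

Section Kernel.
Variables (R : superRingType) (M N : superRmodType R) (f : rmodHom M N).

Let lin_f := superHom_lin f.

Definition rker_pred : {pred M} := fun x => `[< f x = 0 >].

Lemma rker_pred_zmod_closed : zmod_closed rker_pred.
Proof.
split=> [|x y /asboolP hx /asboolP hy]; apply/asboolP; first exact: rlinear0 lin_f.
by rewrite (rlinearB lin_f) hx hy subrr.
Qed.

HB.instance Definition _ :=
  GRing.isZmodClosed.Build M rker_pred rker_pred_zmod_closed.

Record rker := Rker { rker_val :> M; rker_in : rker_val \in rker_pred }.

HB.instance Definition _ := [isSub for rker_val].
HB.instance Definition _ := [Choice of rker by <:].
HB.instance Definition _ := [SubChoice_isSubZmodule of rker by <:].

Definition mk_rker x (hx : f x = 0) : rker := Rker (introT (asboolP _) hx).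

Lemma rkerP (x : rker) : f x = 0.
Proof. exact/asboolP/rker_in. Qed.

(** The kernel is graded: [f (part i x)] has degree [i], and since [f x = 0] it equals
    [- f (x - part i x)], of degree [~~ i]. *)
Lemma rker_part i (x : rker) : f (part i (x : M)) = 0.
Proof.
apply: (@grade_disj _ i); first exact: (rmodHom_even f) (part_grade i _).
rewrite -[X in grade _ X]opprK -[- f _]add0r -{1}(rkerP x) -(rlinearB lin_f).
by apply: gradeN; exact: (rmodHom_even f) (part_compl i _).
Qed.

Definition rker_grade (i : bool) (x : rker) : Prop := grade i (x : M).

Lemma rker_grade0 i : rker_grade i 0.
Proof. exact: grade0. Qed.

Lemma rker_gradeB i x y : rker_grade i x -> rker_grade i y -> rker_grade i (x - y).
Proof. exact: gradeB. Qed.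

Lemma rker_grade_split x : exists x0 x1,
  [/\ rker_grade false x0, rker_grade true x1 & x = x0 + x1].
Proof.
exists (mk_rker (rker_part false x)), (mk_rker (rker_part true x)).
split; [exact: part_grade | exact: part_grade |].
by apply/val_inj; rewrite /= part_sum.
Qed.

Lemma rker_grade_disjoint x : rker_grade false x -> rker_grade true x -> x = 0.
Proof. by move=> h0 h1; apply/val_inj; exact: grade_disjoint. Qed.

HB.instance Definition _ := isSuperZmodule.Build rker
  rker_grade0 rker_gradeB rker_grade_split rker_grade_disjoint.

Lemma rker_ract_subproof (x : rker) (r : R) : f ((x : M) :* r) = 0.
Proof. by rewrite (rlinearZ lin_f) rkerP ract0l. Qed.

Definition rker_ract x r : rker := mk_rker (rker_ract_subproof x r).

Lemma rker_ractA x a b : rker_ract (rker_ract x a) b = rker_ract x (a * b).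
Proof. by apply/val_inj; exact: ractA. Qed.

Lemma rker_ract1 x : rker_ract x 1 = x.
Proof. by apply/val_inj; exact: ract1. Qed.

Lemma rker_ractDl x y a : rker_ract (x + y) a = rker_ract x a + rker_ract y a.
Proof. by apply/val_inj; exact: ractDl. Qed.

Lemma rker_ractDr x a b : rker_ract x (a + b) = rker_ract x a + rker_ract x b.
Proof. by apply/val_inj; exact: ractDr. Qed.

Lemma rker_grade_ract i j x a :
  grade i x -> grade j a -> grade (i (+) j) (rker_ract x a).
Proof. exact: grade_ract. Qed.

HB.instance Definition _ := isSuperRmodule.Build R rker
  rker_ractA rker_ract1 rker_ractDl rker_ractDr rker_grade_ract.

Lemma rker_val_lin : rlinear (rker_val : rker -> M).
Proof. by []. Qed.

Definition rker_incl : rmodHom rker M :=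
  mkRmodHom rker_val_lin (fun i x hx => hx).

(** [projective] is phrased through short exact sequences, so a surjection is completed by its
    kernel before projectivity can be applied to it. *)
Lemma rker_short_exact : (forall y, exists x, f x = y) -> short_exact rker_incl f.
Proof.
move=> f_surj; split=> // [x y /val_inj // | y].
split=> [hy | [x <-]]; last exact: rkerP.
by exists (mk_rker hy).
Qed.

End Kernel.

(** The section is a lift of the identity of P along [f]. *)
Lemma projective_section (R : superRingType) (P M : superRmodType R)
    (f : rmodHom M P) :
  projective P -> (forall y, exists x, f x = y) ->
  exists g : rmodHom P M, cancel g f.
Proof.
move=> projP f_surj.
have [_ _ /(_ (rmodHom_id P)) [g fg]] := projP _ _ _ _ _ (rker_short_exact f_surj).
by exists g => x; rewrite -[RHS]/(rmodHom_id P x) -fg.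
Qed.

(** The forms [q_] are the coordinates of a section [s] of a surjection [f] from a free module. The
    identity [f (s p) = p] is then the claimed expansion. *)
Lemma dual_basis (R : superRingType) (P : superRmodType R) :
  finitely_generated P -> projective P ->
  exists (n : nat) (p_ : 'I_n -> P) (q_ : 'I_n -> superDual P),
    forall p, p = \sum_i p_ i :* q_ i p.
Proof.
move=> [n [e e_gen]] projP.
pose I := ('I_n * bool)%type.
(* Splitting the generators into homogeneous parts makes the presentation even. *)
pose p_ (k : I) : P := part k.2 (e k.1).
pose F : superRmodType R := shifted_free R (fun k : I => k.2).
pose f (v : F) : P := \sum_k p_ k :* v k.
have lin_f : rlinear f.
  move=> r u v; have fD : f (u :* r + v) = f (u :* r) + f v.
    by rewrite -big_split; apply: eq_bigr => k _; exact: ractDr.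
  rewrite fD; congr (_ + _).
  have rD : {morph (fun p : P => p :* r) : x y / x + y} by move=> x y; exact: ractDl.
  rewrite /f (big_morph _ rD (ract0l _ r)).
  by apply: eq_bigr => k _; rewrite ractA.
have even_f i v : grade i v -> grade i (f v).
  move=> hv; rewrite /f; elim/big_ind: _ => [|x y hx hy|k _]; first exact: grade0.
    exact: gradeD.
  (* The degree of the summand is [k.2 (+) (i (+) k.2)], that is [i]. *)
  have := grade_ract _ _ _ _ (part_grade k.2 (e k.1)) (hv k).
  by rewrite addbC addbK.
have f_surj p : exists v, mkRmodHom lin_f even_f v = p.
  (* Both parts of [e i] receive the same coefficient [c i], so that they add up to [e i :* c i]. *)
  have [c ->] := e_gen p; exists (fun k => c k.1).
  rewrite /= /f -(pair_bigA _ (fun i b => part b (e i) :* c i)) /=.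
  apply: eq_bigr => i _.
  by rewrite big_bool /= -ractDl addrC part_sum.
have [s sK] := projective_section projP f_surj.
have lin_q k : rlinear (fun p : P => (s p : F) k : R^o).
  by move=> r u v; rewrite (superHom_lin s).
(* [enum_val] reindexes the pairs in [I] by an ordinal. *)
exists #|{: I}|, (fun j => p_ (enum_val j)).
exists (fun j => mkSuperHom (lin_q (enum_val j))) => p.
rewrite -[LHS]sK /= /f (big_enum_val (fun k => p_ k :* (s p : F) k)) /=.
by rewrite big_enum_val.
Qed.

(** * Generators and the trace ideal *)

(** A graded submodule: closure under [part] is what makes the even and odd classes of the quotient
    meet only in 0. *)
Record super_submod (R : superRingType) (M : superRmodType R) := SuperSubmod {
  submod_mem :> M -> Prop;
  submod0 : submod_mem 0;
  submodB : forall x y, submod_mem x -> submod_mem y -> submod_mem (x - y);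
  submod_ract : forall x r, submod_mem x -> submod_mem (x :* r);
  submod_part : forall i x, submod_mem x -> submod_mem (part i x) }.

(** * Quotients by graded submodules *)

Section Quotient.
Variables (R : superRingType) (M : superRmodType R) (K : super_submod M).

Definition rquot_pred : {pred M} := fun x => `[< K x >].

Lemma rquot_pred_zmod_closed : zmod_closed rquot_pred.
Proof.
split=> [|x y /asboolP hx /asboolP hy]; apply/asboolP; first exact: submod0.
exact: submodB.
Qed.

HB.instance Definition _ :=
  GRing.isZmodClosed.Build M rquot_pred rquot_pred_zmod_closed.

Definition rquot : Type := Quotient.quot rquot_pred.

HB.instance Definition _ :=
  GRing.Zmodule.copy rquot (Quotient.quot rquot_pred).

Definition rquot_pi (x : M) : rquot := \pi_(Quotient.quot rquot_pred)%qT x.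

Lemma rquot_piB : zmod_morphism rquot_pi.
Proof. by move=> x y; rewrite /rquot_pi raddfB. Qed.

Lemma rquot_pi_eq x y : rquot_pi x = rquot_pi y <-> K (x - y).
Proof.
split=> [e|h].
  by apply/asboolP; rewrite -[`[< _ >]]/(x - y \in rquot_pred)
    Quotient.idealrBE; apply/eqP.
by apply/eqP; rewrite /rquot_pi -Quotient.idealrBE; apply/asboolP.
Qed.

Lemma rquot_pi0 x : K x -> rquot_pi x = 0.
Proof.
by move=> hx; rewrite -(zmod_morphism0 rquot_piB); apply/rquot_pi_eq; rewrite subr0.
Qed.

Lemma rquot_pi_surj (t : rquot) : exists x, t = rquot_pi x.
Proof. by exists (repr (t : Quotient.quot rquot_pred)); rewrite /rquot_pi reprK. Qed.

Definition rquot_grade (i : bool) (t : rquot) : Prop :=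
  exists2 x, grade i x & t = rquot_pi x.

Lemma rquot_grade0 i : rquot_grade i 0.
Proof. by exists 0; [exact: grade0 | rewrite (zmod_morphism0 rquot_piB)]. Qed.

Lemma rquot_gradeB i t u :
  rquot_grade i t -> rquot_grade i u -> rquot_grade i (t - u).
Proof.
move=> [x hx ->] [y hy ->]; exists (x - y); first exact: gradeB.
by rewrite rquot_piB.
Qed.

Lemma rquot_grade_split t : exists t0 t1,
  [/\ rquot_grade false t0, rquot_grade true t1 & t = t0 + t1].
Proof.
have [x ->] := rquot_pi_surj t.
exists (rquot_pi (part false x)), (rquot_pi (part true x)); split.
- by exists (part false x) => //; exact: part_grade.
- by exists (part true x) => //; exact: part_grade.
- by rewrite -(zmod_morphismD rquot_piB) part_sum.
Qed.

(** If even [x] and odd [y] represent the same class, then [x - y] lies in [K], and so does its even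
    part, which is [x]. *)
Lemma rquot_grade_disjoint t : rquot_grade false t -> rquot_grade true t -> t = 0.
Proof.
move=> [x hx ->] [y hy /rquot_pi_eq/(submod_part false)].
by rewrite partB (part_id hx) (part_neg (i := false) hy) subr0; exact: rquot_pi0.
Qed.

HB.instance Definition _ := isSuperZmodule.Build rquot
  rquot_grade0 rquot_gradeB rquot_grade_split rquot_grade_disjoint.

Definition rquot_ract (t : rquot) (r : R) : rquot :=
  rquot_pi (repr (t : Quotient.quot rquot_pred) :* r).

(** Independence of the representative chosen by [repr]: two representatives differ by an element of
    [K], which is stable under the action. *)
Lemma rquot_ractE x r : rquot_ract (rquot_pi x) r = rquot_pi (x :* r).
Proof.
apply/rquot_pi_eq; rewrite -ractBl; apply: submod_ract; apply/rquot_pi_eq.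
by rewrite /rquot_pi reprK.
Qed.

Lemma rquot_ractA t a b : rquot_ract (rquot_ract t a) b = rquot_ract t (a * b).
Proof. by have [x ->] := rquot_pi_surj t; rewrite !rquot_ractE ractA. Qed.

Lemma rquot_ract1 t : rquot_ract t 1 = t.
Proof. by have [x ->] := rquot_pi_surj t; rewrite rquot_ractE ract1. Qed.

Lemma rquot_ractDl t u a :
  rquot_ract (t + u) a = rquot_ract t a + rquot_ract u a.
Proof.
have [[x ->] [y ->]] := (rquot_pi_surj t, rquot_pi_surj u).
have piD := zmod_morphismD rquot_piB.
by rewrite -piD !rquot_ractE ractDl piD.
Qed.

Lemma rquot_ractDr t a b :
  rquot_ract t (a + b) = rquot_ract t a + rquot_ract t b.
Proof.
have [x ->] := rquot_pi_surj t.
by rewrite !rquot_ractE ractDr (zmod_morphismD rquot_piB).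
Qed.

Lemma rquot_grade_ract i j t a :
  grade i t -> grade j a -> grade (i (+) j) (rquot_ract t a).
Proof.
move=> [x hx ->] ha; exists (x :* a); first exact: grade_ract.
by rewrite rquot_ractE.
Qed.

HB.instance Definition _ := isSuperRmodule.Build R rquot
  rquot_ractA rquot_ract1 rquot_ractDl rquot_ractDr rquot_grade_ract.

Lemma rquot_pi_lin : rlinear rquot_pi.
Proof.
by move=> r u v; rewrite (zmod_morphismD rquot_piB) [in RHS]/ract /= rquot_ractE.
Qed.

Lemma rquot_pi_even i x : grade i x -> grade i (rquot_pi x).
Proof. by move=> hx; exists x. Qed.

Definition rquot_hom : rmodHom M rquot := mkRmodHom rquot_pi_lin rquot_pi_even.

End Quotient.

(** * The trace ideal of P *)

Section Trace.
Variables (R : superRingType) (P : superRmodType R).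

Definition trace_mem : R^o -> Prop :=
  zspan (fun x => exists (q : superDual P) (p : P), x = q p).

Lemma trace_ract x r : trace_mem x -> trace_mem (x :* r).
Proof.
elim=> [_ [q [p ->]] | | y z _ hy _ hz].
- by apply: zspan_gen; exists q, (p :* r); rewrite (rlinearZ (superHom_lin q)).
- by rewrite ract0l; exact: zspan0.
- by rewrite ractBl; exact: zspanB.
Qed.

(** For [p] of degree [a], the component of degree [i] of [q p] is the value at [p] of the component
    of degree [i (+) a] of [q], hence again a value of a linear form. *)
Lemma trace_part i x : trace_mem x -> trace_mem (part i x).
Proof.
elim=> [_ [q [p ->]] | | y z _ hy _ hz].
- have homog a : trace_mem (part i (q (part a p))).
    apply: zspan_gen; exists (mkSuperHom (superHom_part_lin (i (+) a) q)), (part a p).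
    by rewrite /= (superHom_partE _ q (part_grade a p)) addbK.
  rewrite -[p]part_sum (rlinearD (superHom_lin q)) partD.
  exact: zspanD (homog _) (homog _).
- by rewrite part0; exact: zspan0.
- by rewrite partB; exact: zspanB.
Qed.

Definition trace_submod : super_submod R^o :=
  SuperSubmod (zspan0 _) (@zspanB _ _) trace_ract trace_part.

Lemma trace_sum x : trace_mem x ->
  exists (n : nat) (q_ : 'I_n -> superDual P) (p_ : 'I_n -> P),
    x = \sum_i q_ i (p_ i).
Proof.
move=> hx; suff [s ->] : exists s : seq (superDual P * P), x = \sum_(u <- s) u.1 u.2.
  exists (size s), (fun i => (tnth (in_tuple s) i).1).
  by exists (fun i => (tnth (in_tuple s) i).2); rewrite big_tnth.
elim: hx => [_ [q [p ->]] | | y z _ [s ->] _ [s' ->]].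
- by exists [:: (q, p)]; rewrite big_seq1.
- by exists [::]; rewrite big_nil.
(* The sign of a difference is absorbed into the argument: - q(p) = q(- p). *)
- exists (s ++ [seq (u.1, - u.2) | u <- s']).
  rewrite big_cat big_map -sumrN /=; congr (_ + _); apply: eq_bigr => u _.
  by rewrite (rlinearN (superHom_lin u.1)).
Qed.

(** The maps tested by [generator] and the forms spanning the trace both have arbitrary parity, so
    every composite of a test map with the projection vanishes. The projection is then 0, and its
    value at 1 gives the claim. *)
Lemma generator_trace1 : generator P -> trace_mem 1.
Proof.
move=> genP; have pi0 : rquot_hom trace_submod = 0.
  apply: genP => h; apply: superHomP => p; apply: rquot_pi0.
  by apply: zspan_gen; exists h, p.
have : rquot_pi trace_submod 1 = rquot_pi trace_submod 0.
  by rewrite (zmod_morphism0 (@rquot_piB _ _ trace_submod)) -[LHS]/(rquot_hom trace_submod (1 : R^o)) pi0.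
by move=> /rquot_pi_eq; rewrite subr0.
Qed.

End Trace.

(** * The Morita context of P *)

Section EvaluationPairings.
Variables (R : superRingType) (P : superRmodType R).
Implicit Types (p : P) (q : superDual P).

Definition eval_pairing (q : superDual P) (p : evalBimod P) : R := q p.

Lemma eval_pairingP : @super_pairing R (superEnd P) (superDual P) (evalBimod P)
  eval_pairing.
Proof.
split=> // [q p p' | q p a | i j q p hq hp].
- exact: rlinearD (superHom_lin q) _ _.
- exact: rlinearZ (superHom_lin q) _ _.
- exact: hq.
Qed.

Lemma rank1_lin p q : rlinear (fun p' : P => p :* q p').
Proof. by move=> r u v; rewrite (superHom_lin q) ractDr -ractA. Qed.

Definition rank1 (p : evalBimod P) (q : superDual P) : superEnd P :=
  mkSuperHom (rank1_lin p q).

Lemma rank1P : @super_pairing (superEnd P) R (evalBimod P) (superDual P) rank1.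
Proof.
split=> [p p' q | p q q' | s p q | p q s | p r q | i j p q hp hq].
- by apply: superHomP => x; exact: ractDl.
- by apply: superHomP => x; exact: ractDr.
- by apply: superHomP => x; exact: esym (rlinearZ (superHom_lin s) _ _).
- by apply: superHomP => x.
- by apply: superHomP => x; exact: ractA.
- by move=> k x hx; rewrite -addbA; apply: grade_ract => //; exact: hq.
Qed.

(** At p' this reads q(p) q'(p') = q(p q'(p')), the linearity of q. *)
Lemma eval_pairing_rank1 q p q' : eval_pairing q p *: q' = q :* rank1 p q'.
Proof. by apply: superHomP => x; exact: esym (rlinearZ (superHom_lin q) _ _). Qed.

Lemma rank1_eval_pairing p q (p' : evalBimod P) :
  rank1 p q *: p' = (p : evalBimod P) :* eval_pairing q p'.
Proof. by []. Qed.

End EvaluationPairings.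

Theorem theorem3p2p1 (R : superRingType) (P : superRmodType R)
    (hP : progenerator P) :
  let S : superRingType := superEnd P in
  let Q : superBimodType R S := superDual P in
  let PSR : superBimodType S R := evalBimod P in
  (mutually_inverse_equivalences
     (tensorR Q : functor (rmodCat R) (rmodCat S))
     (tensorR PSR : functor (rmodCat S) (rmodCat R))) /\
  (mutually_inverse_equivalences
     (tensorL PSR : functor (lmodCat R) (lmodCat S))
     (tensorL Q : functor (lmodCat S) (lmodCat R))).
Proof.
have [fgP projP genP] := hP.
have [m [p_ [q_ basis]]] := dual_basis fgP projP.
have [n [q'_ [p'_ tr]]] := trace_sum (generator_trace1 genP).
move=> S Q PSR.
have muP := @eval_pairingP R P; have nuP := @rank1P R P.
have mu_nu := @eval_pairing_rank1 R P; have nu_mu := @rank1_eval_pairing R P.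
have mu1 : \sum_i @eval_pairing R P (q'_ i) (p'_ i) = 1 by rewrite tr.
(* The dual basis expansion says that the identity of P is a sum of rank one maps. *)
have nu1 : \sum_i @rank1 R P (p_ i) (q_ i) = 1.
  apply: superHomP => p; rewrite [RHS]basis.
  have evD : {morph (fun s : superEnd P => (s : superHom P P) p) : s t / s + t} by [].
  by rewrite (big_morph _ evD erefl).
(* The context over R uses [mu1], from the generator property; the exchanged context over S uses
   [nu1], from finite generation and projectivity. *)
split; split.
- exact (tensorR_can muP mu_nu nu_mu mu1).
- exact (tensorR_can nuP nu_mu mu_nu nu1).
- exact (tensorL_can muP mu_nu nu_mu mu1).
- exact (tensorL_can nuP nu_mu mu_nu nu1).
Qed.
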